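(* Let $k$ be an algebraically closed field of characteristic $p=2$ and let $G$ be simple of type $G_2$ over $k$, with short simple root $\alpha_1$ and long simple root $\alpha_2$. Then the proper $p$-Lie subalgebras of $\operatorname{Lie}G$ strictly containing $\operatorname{Lie}P^{\alpha_1}$ are exactly $$\mathfrak h=\operatorname{Lie}P^{\alpha_1}\oplus\mathfrak g_{-2\alpha_1-\alpha_2}\qquad\text{and}\qquad\mathfrak l=\operatorname{Lie}P^{\alpha_1}\oplus\mathfrak g_{-\alpha_1}\oplus\mathfrak g_{-\alpha_1-\alpha_2}.$$
   Context: Fix a Borel subgroup $B\subset G$ and a maximal torus $T\subset B$ defining the simple roots. $\mathfrak g_\gamma=\operatorname{Lie}U_\gamma$ is the root space of $\gamma$, where $U_\gamma$ is the root subgroup. $P^{\alpha_1}$ is the maximal reduced parabolic subgroup generated by $B$ and $U_{-\alpha_2}$, so $\operatorname{Lie}P^{\alpha_1}=\operatorname{Lie}B\oplus\mathfrak g_{-\alpha_2}$. A $p$-Lie subalgebra is a Lie subalgebra stable under the $p$-mapping of $\operatorname{Lie}G$. *)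

(* Defs.v *)
From HB Require Import structures.
From mathcomp Require Import all_boot all_order all_algebra.
From mathcomp Require Import boolp classical_sets.
From mathcomp Require Import mpoly.

Set Implicit Arguments.
Unset Strict Implicit.
Unset Printing Implicit Defensive.

Import Order.TTheory GRing.Theory.

Local Open Scope classical_set_scope.
Local Open Scope ring_scope.

(* Linear algebraic groups over an algebraically closed field k are Zariski   *)
(* closed subgroups of some GL_n(k), identified with their sets of k-points   *)
(* in 'M[k]_n.                                                                *)

Section LinearAlgebraicGroups.
Variable k : closedFieldType.

(* Polynomials in the entries of an n x n matrix, the entry (i, j) being the  *)
(* variable of index mxvec_index i j.                                         *)
Definition mxpol (n : nat) := {mpoly k[n * n]}.

Definition mxeval (n : nat) (f : mxpol n) (A : 'M[k]_n) : k :=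
  f.@[mxvec A 0].

(* The differential of f at the identity, in the direction X. *)
Definition mxdiff1 (n : nat) (f : mxpol n) (X : 'M[k]_n) : k :=
  \sum_(i < n * n) mxvec X 0 i * mxeval f^`M(i) 1%:M.

(* Closed in GL_n: denominators \det ^+ e do not change zero loci. *)
Definition zclosed (n : nat) (S : set 'M[k]_n) : Prop :=
  exists I : set (mxpol n),
    S = [set A | A \in unitmx /\ forall f, I f -> mxeval f A = 0].

Definition zconnected (n : nat) (S : set 'M[k]_n) : Prop :=
  forall C D : set 'M[k]_n, zclosed C -> zclosed D ->
    S `<=` C `|` D -> S `&` C `&` D = set0 -> S `<=` C \/ S `<=` D.

Definition subgroup (n : nat) (S : set 'M[k]_n) : Prop :=
  [/\ S `<=` [set A | A \in unitmx], S 1%:M,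
      (forall A B, S A -> S B -> S (A *m B)) &
      (forall A, S A -> S (invmx A))].

Definition closed_subgroup (n : nat) (S : set 'M[k]_n) : Prop :=
  zclosed S /\ subgroup S.

Definition generated (n : nat) (S : set 'M[k]_n) : set 'M[k]_n :=
  [set A | forall H, subgroup H -> S `<=` H -> H A].

Definition derived_subgroup (n : nat) (S : set 'M[k]_n) : set 'M[k]_n :=
  generated [set C | exists A B, [/\ S A, S B &
                       C = A *m B *m invmx A *m invmx B]].

Definition solvable_subgroup (n : nat) (S : set 'M[k]_n) : Prop :=
  exists m, iter m (@derived_subgroup n) S `<=` [set 1%:M].

(* Almost simple: the center is allowed to be finite and nontrivial. *)
Definition simple_group (n : nat) (G : set 'M[k]_n) : Prop :=
  [/\ closed_subgroup G, zconnected G,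
      ~ (forall A B, G A -> G B -> A *m B = B *m A) &
      forall N, closed_subgroup N -> zconnected N -> N `<=` G ->
        (forall A B, G A -> N B -> N (A *m B *m invmx A)) ->
        N = [set 1%:M] \/ N = G].

Definition torus (n : nat) (T : set 'M[k]_n) : Prop :=
  [/\ closed_subgroup T, zconnected T &
      exists2 Q, Q \in unitmx &
        forall t, T t -> is_diag_mx (Q *m t *m invmx Q)].

Definition maximal_torus (n : nat) (G T : set 'M[k]_n) : Prop :=
  [/\ torus T, T `<=` G &
      forall T', torus T' -> T' `<=` G -> T `<=` T' -> T' = T].

Definition borel (n : nat) (G B : set 'M[k]_n) : Prop :=
  let csc H := [/\ closed_subgroup H, zconnected H & solvable_subgroup H] in
  [/\ csc B, B `<=` G &
      forall B', csc B' -> B' `<=` G -> B `<=` B' -> B' = B].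

Definition regular_fun (m : nat) (D : set 'M[k]_m) (f : 'M[k]_m -> k) : Prop :=
  exists (g : mxpol m) (e : nat),
    forall A, D A -> f A = mxeval g A / (\det A) ^+ e.

Definition regular_map (m n : nat) (D : set 'M[k]_m)
    (F : 'M[k]_m -> 'M[k]_n) : Prop :=
  forall i j, regular_fun D (fun A => F A i j).

Definition group_morphism (m n : nat) (D : set 'M[k]_m) (E : set 'M[k]_n)
    (F : 'M[k]_m -> 'M[k]_n) : Prop :=
  [/\ regular_map D F, (forall A, D A -> E (F A)) &
      forall A B, D A -> D B -> F (A *m B) = F A *m F B].

Definition character (n : nat) (T : set 'M[k]_n) (chi : 'M[k]_n -> k) : Prop :=
  [/\ regular_fun T chi, chi 1%:M = 1 &
      forall s t, T s -> T t -> chi (s *m t) = chi s * chi t].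

(* The subspace with underlying set P (junk if P is not a subspace). *)
Definition vspace_of (V : vectType k) (P : set V) : {vspace V} :=
  xget 0%VS [set U : {vspace V} | forall v, v \in U <-> P v].

(* The tangent space at the identity of the closure of S, inside gl_n. *)
Definition tangent1 (n : nat) (S : set 'M[k]_n) : set 'M[k]_n :=
  [set X | forall f : mxpol n,
             (forall A, S A -> mxeval f A = 0) -> mxdiff1 f X = 0].

Definition lie (n : nat) (S : set 'M[k]_n) : {vspace 'M[k]_n} :=
  vspace_of (tangent1 S).

(* The p-mapping of the Lie algebra of a closed subgroup of GL_n is the       *)
(* p-th power of matrices.                                                    *)
Definition p_lie_subalgebra (p n : nat) (g s : {vspace 'M[k]_n}) : Prop :=
  [/\ (s <= g)%VS,
      (forall X Y, X \in s -> Y \in s -> X *m Y - Y *m X \in s) &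
      (forall X, X \in s -> X ^+ p \in s)].

Definition weight_vector (n : nat) (T : set 'M[k]_n) (chi : 'M[k]_n -> k)
    (X : 'M[k]_n) : Prop :=
  forall t, T t -> t *m X *m invmx t = chi t *: X.

Definition is_root (n : nat) (G T : set 'M[k]_n) (chi : 'M[k]_n -> k) : Prop :=
  [/\ character T chi, (exists2 t, T t & chi t != 1) &
      exists X, [/\ X \in lie G, X != 0 & weight_vector T chi X]].

Definition SL2 : set 'M[k]_2 := [set A | \det A = 1].
Definition upper2 (a : k) : 'M[k]_2 := 1%:M + a *: delta_mx 0 1.
Definition lower2 (a : k) : 'M[k]_2 := 1%:M + a *: delta_mx 1 0.
Definition diag2 (c : k) : 'M[k]_2 :=
  c *: delta_mx 0 0 + c^-1 *: delta_mx 1 1.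

(* The pair (a, b) stands for the weight a alpha1 + b alpha2. *)
Definition wt (n : nat) (alpha1 alpha2 : 'M[k]_n -> k) (g : int * int)
    (t : 'M[k]_n) : k :=
  alpha1 t ^ g.1 * alpha2 t ^ g.2.

Definition G2_pos_roots : seq (int * int) :=
  [:: (1, 0); (0, 1); (1, 1); (2, 1); (3, 1); (3, 2)].

Definition G2_roots : seq (int * int) :=
  G2_pos_roots ++ [seq - g | g <- G2_pos_roots].

(* phi g : SL_2 -> G is the homomorphism attached to the root g; U_g is the   *)
(* image of the upper unipotent matrices and c |-> phi g (diag2 c) is the     *)
(* coroot of g.                                                               *)
Definition root_subgroup (n : nat) (phi : int * int -> 'M[k]_2 -> 'M[k]_n)
    (g : int * int) : set 'M[k]_n :=
  [set phi g (upper2 a) | a in [set: k]].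

(* (G, T) has a root system of type G_2 with basis alpha1 (short) and alpha2  *)
(* (long), and phi realizes it in G (Springer, Linear algebraic groups, 8.1;  *)
(* Jantzen, Representations of algebraic groups, II.1.1-1.3). For a simple    *)
(* group G of type G_2 such a phi always exists.                              *)
Record G2_realization (n : nat) (G T : set 'M[k]_n)
    (alpha1 alpha2 : 'M[k]_n -> k)
    (phi : int * int -> 'M[k]_2 -> 'M[k]_n) : Prop := {
  G2_char1 : character T alpha1;
  G2_char2 : character T alpha2;
  G2_rootsP : forall chi, character T chi ->
    is_root G T chi <->
    exists2 g, g \in G2_roots & forall t, T t -> chi t = wt alpha1 alpha2 g t;
  G2_phi_morph : forall g, g \in G2_roots -> group_morphism SL2 G (phi g);
  G2_phi_opp : forall g a, g \in G2_roots ->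
    phi g (lower2 a) = phi (- g) (upper2 a);
  (* a |-> phi g (upper2 a) is an isomorphism from the additive group to U_g *)
  G2_phi_iso : forall g, g \in G2_roots ->
    exists2 psi, regular_fun (root_subgroup phi g) psi &
      forall a, psi (phi g (upper2 a)) = a;
  G2_phi_conj : forall g t a, g \in G2_roots -> T t ->
    t *m phi g (upper2 a) *m invmx t
      = phi g (upper2 (wt alpha1 alpha2 g t * a));
  G2_coroot : forall g c, g \in G2_roots -> c != 0 -> T (phi g (diag2 c));
  (* the Cartan integers <alpha_j, alpha_i^vee> *)
  G2_cartan : forall c, c != 0 ->
    [/\ alpha1 (phi (1, 0) (diag2 c)) = c ^ 2,
        alpha2 (phi (1, 0) (diag2 c)) = c ^ (- 3),
        alpha1 (phi (0, 1) (diag2 c)) = c ^ (- 1) &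
        alpha2 (phi (0, 1) (diag2 c)) = c ^ 2];
  G2_lie_decomposition :
    lie G = (lie T + \sum_(g <- G2_roots) lie (root_subgroup phi g))%VS
}.

(* For a Borel subgroup B containing T: B is the one for which alpha1, alpha2 *)
(* are the simple roots.                                                      *)
Definition G2_borel (n : nat) (T B : set 'M[k]_n)
    (phi : int * int -> 'M[k]_2 -> 'M[k]_n) : Prop :=
  B = generated (T `|` [set A | exists2 g, g \in G2_pos_roots &
                                  root_subgroup phi g A]).

(* P^{alpha1} *)
Definition G2_parabolic1 (n : nat) (B : set 'M[k]_n)
    (phi : int * int -> 'M[k]_2 -> 'M[k]_n) : set 'M[k]_n :=
  generated (B `|` root_subgroup phi (0, -1)).

Lemma vspace_ofP (V : vectType k) (P : set V) :
  P 0 -> (forall (a : k) u v, P u -> P v -> P (a *: u + v)) ->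
  forall v, v \in vspace_of P <-> P v.
Proof.
move=> P0 PL.
suff [U UP] : exists U : {vspace V}, forall v, v \in U <-> P v.
  exact: (@xgetPex _ 0%VS [set U : {vspace V} | forall v, v \in U <-> P v]
            (ex_intro _ U UP)).
apply: contrapT => noU.
have step m : exists2 U : {vspace V}, (forall v, v \in U -> P v) & (m <= \dim U)%N.
  elim: m => [|m [U UP mU]].
    by exists 0%VS => // v; rewrite memv0 => /eqP ->.
  have [w Pw wU] : exists2 w, P w & w \notin U.
    apply: contrapT => no; apply: noU; exists U => v; split=> [|Pv]; first exact: UP.
    by apply: contrapT => /negP vU; apply: no; exists v.
  exists (U + <[w]>)%VS.
    move=> v /memv_addP[u uU [_ /vlineP[a ->] ->]].
    by rewrite addrC; apply: PL => //; exact: UP.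
  apply: (leq_ltn_trans mU); rewrite ltnNge; apply/negP => le.
  have /eqP E : (U == U + <[w]>)%VS by rewrite eqEdim addvSl le.
  by move/negP: wU; apply; rewrite E memvE addvSr.
have [U _] := step (\dim {: V}).+1.
by rewrite ltnNge dimvS ?subvf.
Qed.

Lemma lieP (n : nat) (S : set 'M[k]_n) (X : 'M[k]_n) :
  X \in lie S <-> tangent1 S X.
Proof.
apply: vspace_ofP => [f _|a Y Z PY PZ f fS]; rewrite /mxdiff1.
  by rewrite linear0 big1 // => i _; rewrite mxE mul0r.
have {PY} := PY f fS; have {PZ} := PZ f fS; rewrite /mxdiff1 => EZ EY.
rewrite (eq_bigr (fun i => a * (mxvec Y 0 i * mxeval f^`M(i) 1%:M)
                             + mxvec Z 0 i * mxeval f^`M(i) 1%:M)).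
  by rewrite big_split /= -mulr_sumr EY EZ mulr0 addr0.
by move=> i _; rewrite linearP /= !mxE mulrDl mulrA.
Qed.

End LinearAlgebraicGroups.

(* Main.v *)
Require Import Defs.
From HB Require Import structures.
From mathcomp Require Import all_boot all_order all_algebra.
From mathcomp Require Import boolp classical_sets.
From mathcomp Require Import mpoly.
From mathcomp Require Import ring zify.

Set Implicit Arguments.
Unset Strict Implicit.
Unset Printing Implicit Defensive.

Import Order.TTheory GRing.Theory.

Local Open Scope classical_set_scope.
Local Open Scope ring_scope.

(* The root vector e_g is the velocity of the root subgroup x_g, and every    *)
(* structure constant that matters is read off the action of SL_2 on a root   *)
(* string: on a lowest weight vector v of weight -m, the coefficient of a^m   *)
(* in Ad(x_g(a)) v is the Weyl element applied to v, hence nonzero. For long  *)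
(* simple roots (m = 1) this is a bracket. For short ones (m = 3) the string  *)
(* is a Steinberg module in characteristic 2, so that the middle bracket      *)
(* vanishes and the two outer ones do not. Consequently e_{-2 alpha1-alpha2}  *)
(* is killed by e_alpha1 and e_{alpha1+alpha2}, and e_{-alpha1} commutes with *)
(* e_{-alpha1-alpha2}: this makes h and l subalgebras, and the nonvanishing   *)
(* brackets show that any other overalgebra of Lie P contains a root vector   *)
(* of degree -3 in alpha1 and then is everything. Lie P itself is identified  *)
(* by P normalizing the span of Lie T and the root vectors of degree >= 0 in  *)
(* alpha1, which is its own normalizer in Lie G.                              *)

(** * Polynomial matrices and tangent spaces *)

(** The roots missing from Lie P have degrees -1, -1, -2, -3, -3 in alpha1. The root vectors of
    alpha2 and -alpha2 lie in Lie P and link the two roots of degree -1 ([subalg_N10]). A nonzero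
    component of degree -3 generates everything ([subalg_full]), and degrees -1 and -2 together
    produce degree -3 through [e_{-alpha1}, e_{-2 alpha1-alpha2}]. So only degree -2 alone, or
    degree -1 alone, can be added ([subalg_classify]). Both additions are closed because the
    brackets that would leave them have structure constants 2 or -2 over the integers
    ([deg0_N21_subalgebra], [degN1_subalgebra]).

    No Chevalley basis is assumed: the constants come from [rvec_string1] and [rvec_string3], which
    rest on [rAd_top], and from the Jacobi identity and a reflection. The p-mapping costs little:
    root vectors square to 0 ([rvec_sqr]), Lie T is stable under squares ([lie_sqr]), and a square
    of a sum differs from the sum of squares by a bracket ([wsp_sqr]). [lie_parabolic] turns the
    abstract group P into the span of Lie T and root vectors, after which every remaining question
    is about finitely many roots. *)

Section PolynomialMatrices.
Variable k : closedFieldType.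

(** If [p] vanishes everywhere then [p + 1] has no root, hence is constant over an algebraically
    closed field. *)
Lemma poly_vanish (p : {poly k}) : (forall a, p.[a] = 0) -> p = 0.
Proof.
move=> p0; have /size_poly1P [c _ E]: size (p + 1) == 1%N.
  apply/negP => /negP/closed_rootP [x].
  by rewrite /root !hornerE p0 add0r oner_eq0.
have := p0 0; rewrite -(addrK 1 p) E !hornerE => /eqP.
by rewrite subr_eq0 => /eqP ->; rewrite subrr.
Qed.

Lemma poly_vanish_unit (p : {poly k}) : (forall a, a != 0 -> p.[a] = 0) -> p = 0.
Proof.
move=> p0; apply/eqP; have /eqP: p * 'X = 0.
  apply: poly_vanish => a; rewrite !hornerE.
  by have [->|/p0 ->] := eqVneq a 0; rewrite ?mulr0 ?mul0r.
by rewrite mulf_eq0 polyX_eq0 orbF.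
Qed.

Lemma exists_not_expr1 m : (0 < m)%N -> exists2 c : k, c != 0 & c ^+ m != 1.
Proof.
move=> m0; apply: contrapT => no.
have /(congr1 (fun p : {poly k} => p`_m)) : 'X^m - 1 = 0 :> {poly k}.
  apply: poly_vanish_unit => a a0; rewrite !hornerE; apply/eqP.
  by rewrite subr_eq0; apply: contrapT => /negP am; apply: no; exists a.
rewrite coefB coefXn coef1 eqxx coef0 eqn0Ngt m0 subr0 => /eqP.
by rewrite oner_eq0.
Qed.

Lemma exprz_inj (i j : int) :
  (forall c : k, c != 0 -> c ^ i = c ^ j) -> i = j.
Proof.
move=> H; apply/eqP; rewrite -subr_eq0; apply: contrapT => /negP ij.
have [c c0] := @exists_not_expr1 `|i - j| ltac:(by rewrite absz_gt0).
have : c ^ (i - j) = 1 by rewrite expfzDr // -invr_expz H // divff ?expfz_neq0.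
case: (i - j) {ij} => m /= E /eqP []; first exact: E.
by apply: invr_inj; rewrite invr1 -E.
Qed.

(** Matrices over [{poly k}] are used as polynomial curves a |-> P(a): [mxcoef i] is the Taylor
    coefficient at 0, and the pair of coefficients 0 and 1 plays the role of a point over the dual
    numbers. *)
Definition mxcoef m n i (P : 'M[{poly k}]_(m, n)) : 'M[k]_(m, n) :=
  map_mx (fun p : {poly k} => p`_i) P.

Definition mxev m n a (P : 'M[{poly k}]_(m, n)) : 'M[k]_(m, n) :=
  map_mx (horner_eval a) P.

Definition mxC m n (A : 'M[k]_(m, n)) : 'M[{poly k}]_(m, n) := map_mx polyC A.

Lemma mxev_mul m n p a (P : 'M[{poly k}]_(m, n)) (Q : 'M_(n, p)) :
  mxev a (P *m Q) = mxev a P *m mxev a Q.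
Proof. exact: map_mxM. Qed.

Lemma mxevC m n a (A : 'M[k]_(m, n)) : mxev a (mxC A) = A.
Proof. by apply/matrixP => i j; rewrite !mxE /horner_eval hornerC. Qed.

Lemma mxevD m n a (P Q : 'M[{poly k}]_(m, n)) : mxev a (P + Q) = mxev a P + mxev a Q.
Proof. exact: map_mxD. Qed.

Lemma mxev_scale m n a p (P : 'M[{poly k}]_(m, n)) :
  mxev a (p *: P) = p.[a] *: mxev a P.
Proof. exact: map_mxZ. Qed.

Lemma mxcoefD m n i (P Q : 'M[{poly k}]_(m, n)) :
  mxcoef i (P + Q) = mxcoef i P + mxcoef i Q.
Proof. by apply/matrixP => r s; rewrite !mxE coefD. Qed.

Lemma mxcoef_sum m n i N (P : 'I_N -> 'M[{poly k}]_(m, n)) :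
  mxcoef i (\sum_j P j) = \sum_j mxcoef i (P j).
Proof.
apply/matrixP => r s; rewrite !mxE !summxE coef_sum.
by apply: eq_bigr => j _; rewrite mxE.
Qed.

Lemma mxcoefC m n i (A : 'M[k]_(m, n)) : mxcoef i (mxC A) = if i == 0%N then A else 0.
Proof. by apply/matrixP => r s; rewrite !mxE coefC; case: eqP => _; rewrite ?mxE. Qed.

Lemma mxcoefMl m n p i A (P : 'M[{poly k}]_(n, p)) :
  mxcoef i (@mxC m n A *m P) = A *m mxcoef i P.
Proof.
apply/matrixP => r s; rewrite !mxE coef_sum; apply: eq_bigr => j _.
by rewrite !mxE coefCM.
Qed.

Lemma mxcoefMr m n p i A (P : 'M[{poly k}]_(m, n)) :
  mxcoef i (P *m @mxC n p A) = mxcoef i P *m A.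
Proof.
apply/matrixP => r s; rewrite !mxE coef_sum; apply: eq_bigr => j _.
by rewrite !mxE coefMC.
Qed.

Lemma mxcoefM m n p i (P : 'M[{poly k}]_(m, n)) (Q : 'M_(n, p)) :
  mxcoef i (P *m Q) = \sum_(j < i.+1) mxcoef j P *m mxcoef (i - j) Q.
Proof.
apply/matrixP => r s; rewrite !mxE coef_sum summxE.
under eq_bigr do rewrite coefM.
rewrite exchange_big /=; apply: eq_bigr => j _; rewrite !mxE.
by apply: eq_bigr => l _; rewrite !mxE.
Qed.

Lemma mxev0 m n (P : 'M[{poly k}]_(m, n)) : mxev 0 P = mxcoef 0 P.
Proof. by apply/matrixP => i j; rewrite !mxE /horner_eval horner_coef0. Qed.

Lemma mxev_inj m n (P Q : 'M[{poly k}]_(m, n)) :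
  (forall a, mxev a P = mxev a Q) -> P = Q.
Proof.
move=> H; apply/matrixP => i j; apply/eqP; rewrite -subr_eq0; apply/eqP.
apply: poly_vanish => a; have := congr1 (fun A : 'M_(m, n) => A i j) (H a).
by rewrite !mxE /horner_eval hornerD hornerN => ->; rewrite subrr.
Qed.

Lemma mxev_inj_unit m n (P Q : 'M[{poly k}]_(m, n)) :
  (forall a, a != 0 -> mxev a P = mxev a Q) -> P = Q.
Proof.
move=> H; apply/matrixP => i j; apply/eqP; rewrite -subr_eq0; apply/eqP.
apply: poly_vanish_unit => a a0.
have := congr1 (fun A : 'M_(m, n) => A i j) (H a a0).
by rewrite !mxE /horner_eval hornerD hornerN => ->; rewrite subrr.
Qed.

Definition mxdeg m n (P : 'M[{poly k}]_(m, n)) : nat :=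
  \max_(i < m) \max_(j < n) size (P i j).

Lemma mxev_sum m n (P : 'M[{poly k}]_(m, n)) N a : (mxdeg P <= N)%N ->
  mxev a P = \sum_(i < N) a ^+ i *: mxcoef i P.
Proof.
move=> le; apply/matrixP => r s; rewrite !mxE summxE /horner_eval.
rewrite (@horner_coef_wide _ N) => [|].
  by apply: eq_bigr => i _; rewrite !mxE mulrC.
apply: leq_trans le; apply: leq_trans (leq_bigmax r).
exact: (leq_bigmax (F := fun s => size (P r s))).
Qed.

(** Applying [f] to the coefficients of [P] gives a polynomial matrix whose values are f(P(a)); it
    vanishes identically. *)
Lemma mxcoef_lin m n p q (f : {linear 'M[k]_(m, n) -> 'M[k]_(p, q)}) P :
  (forall a, f (mxev a P) = 0) -> forall i, f (mxcoef i P) = 0.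
Proof.
(* The bound also exceeds [i], so that coefficient [i] survives the truncation even above the degree
   of [P]. *)
move=> H i; set N := (maxn (mxdeg P) i.+1).
pose Q : 'M[{poly k}]_(p, q) := \matrix_(r, s) \poly_(j < N) f (mxcoef j P) r s.
have cQ j : mxcoef j Q = if (j < N)%N then f (mxcoef j P) else 0.
  by apply/matrixP => r s; rewrite !mxE coef_poly; case: ifP; rewrite ?mxE.
have -> : f (mxcoef i P) = mxcoef i Q by rewrite cQ leq_max ltnSn orbT.
suff -> : Q = 0 by apply/matrixP => r s; rewrite !mxE coef0.
apply: mxev_inj => a; transitivity (f (mxev a P)); last first.
  by rewrite H; apply/matrixP => r s; rewrite !mxE /horner_eval horner0.
rewrite (@mxev_sum _ _ P N) ?leq_maxl // linear_sum /=; apply/matrixP => r s.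
rewrite mxE /horner_eval mxE horner_poly summxE; apply: eq_bigr => j _.
by rewrite linearZ mxE mulrC.
Qed.

(** A linear map with kernel [U]: membership in [U] becomes a linear equation, to which coefficient
    extraction and differentials apply. *)
Definition off m n (U : {vspace 'M[k]_(m, n)}) : {linear 'M[k]_(m, n) -> 'M[k]_(m, n)} :=
  (\1%VF - projv U)%R.

Lemma offP m n (U : {vspace 'M[k]_(m, n)}) v : off U v = 0 <-> v \in U.
Proof.
rewrite /off /= add_lfunE opp_lfunE id_lfunE; split.
  by move/eqP; rewrite subr_eq0 => /eqP ->; exact: memv_proj.
by move=> /projv_id ->; rewrite subrr.
Qed.

Lemma mxcoef_mem m n (U : {vspace 'M[k]_(m, n)}) P :
  (forall a, mxev a P \in U) -> forall i, mxcoef i P \in U.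
Proof. by move=> H i; apply/offP; apply: mxcoef_lin => a; apply/offP. Qed.

End PolynomialMatrices.

(** * Differentials, and the operations under which [lie S] is stable *)

Section Calculus.
Variable k : closedFieldType.

Lemma rmorph_mmap (N : nat) (R1 R2 S : comNzRingType) (f : {rmorphism R1 -> R2})
    (h : {rmorphism R2 -> S}) (v : 'I_N -> R2) (p : {mpoly R1[N]}) :
  h (mmap f v p) = mmap (h \o f) (h \o v) p.
Proof.
rewrite /mmap rmorph_sum; apply: eq_bigr => m _; rewrite rmorphM; congr (_ * _).
by rewrite /mmap1 rmorph_prod; apply: eq_bigr => i _; rewrite rmorphXn.
Qed.

Lemma coef0_mmap (N : nat) (v : 'I_N -> {poly k}) (p : {mpoly k[N]}) :
  (mmap polyC v p)`_0 = p.@[fun i => (v i)`_0].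
Proof.
rewrite -horner_coef0 -[RHS]/(mmap idfun _ p) -[LHS]/(horner_eval 0 _).
rewrite rmorph_mmap; apply: eq_bigr => m _ /=; congr (_ * _).
  by rewrite /horner_eval hornerC.
by apply: eq_bigr => i _ /=; rewrite /horner_eval horner_coef0.
Qed.

(** The first-order chain rule. Both sides obey the Leibniz rule, so constants and variables
    suffice. *)
Lemma coef1_mmap (N : nat) (v : 'I_N -> {poly k}) (p : {mpoly k[N]}) :
  (mmap polyC v p)`_1 =
    \sum_i (v i)`_1 * (p^`M(i)).@[fun i => (v i)`_0].
Proof.
pose w i := (v i)`_0.
pose D (p : {mpoly k[N]}) := \sum_i (v i)`_1 * (p^`M(i)).@[w].
pose C p := (mmap polyC v p)`_1 = D p; rewrite -/(D p) -/(C p).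
have CM p1 p2 : C p1 -> C p2 -> C (p1 * p2).
  rewrite /C => C1 C2; rewrite rmorphM coefM big_ord_recl big_ord1 /=.
  rewrite C1 C2 !coef0_mmap -/w /D mulr_sumr mulr_suml -big_split /=.
  by apply: eq_bigr => i _; rewrite mderivM mevalD !mevalM; ring.
have CC c : C c%:MP.
  by rewrite /C mmapC coefC /= /D big1 // => i _; rewrite mderivC meval0 mulr0.
have CX i : C 'X_i.
  have E j : ('X_i : {mpoly k[N]})^`M(j) = (i == j)%:R%:MP.
    rewrite mderivX mnm1E; case: eqP => [->|_]; last by rewrite scale0r mpolyC0.
    by rewrite scale1r -[X in (X - _)%MM]add0m addmK mpolyX0 mpolyC1.
  rewrite /C mmapX mmap1U /D (bigD1 i) //= big1 => [|j /negbTE ji].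
    by rewrite E eqxx mevalC mulr1 addr0.
  by rewrite E eq_sym ji mevalC mulr0.
elim/mpolyind: p => [|c m p _ _ IH]; first by rewrite -mpolyC0.
rewrite /C mmapD coefD IH.
have -> : (mmap polyC v (c *: 'X_[m]))`_1 = D (c *: 'X_[m]).
  rewrite -mul_mpolyC; apply: (CM) => //; rewrite mpolyXE_id.
  apply: (big_ind C) => [||i _]; [exact: (CC 1)|exact: CM|].
  elim: (m i) => [|e IHe]; first exact: (CC 1).
  by rewrite exprS; apply: (CM).
by rewrite /D -big_split /=; apply: eq_bigr => i _; rewrite mderivD mevalD mulrDr.
Qed.

Variable n : nat.
Implicit Types (f : mxpol k n) (A B X Y : 'M[k]_n) (M : 'M[{poly k}]_n).

Definition mxpev f M : {poly k} := mmap polyC (fun i => mxvec M 0 i) f.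

Definition near1 X : 'M[{poly k}]_n := 1%:M + 'X *: mxC X.

Lemma mxcoef0_near1 X : mxcoef 0 (near1 X) = 1%:M.
Proof.
apply/matrixP => i j; rewrite !mxE coefD mulrC coefMX /= addr0.
by case: (i == j); rewrite ?coef1 ?coef0.
Qed.

Lemma mxcoef1_near1 X : mxcoef 1 (near1 X) = X.
Proof.
apply/matrixP => i j; rewrite !mxE coefD mulrC coefMX /= coefC /=.
by case: (i == j); rewrite ?coef1 ?coef0 add0r.
Qed.

Lemma mxvec_coef i M j : (mxvec M 0 j)`_i = mxvec (mxcoef i M) 0 j.
Proof. by rewrite -map_mxvec !mxE. Qed.

Lemma coef0_mxpev f M : (mxpev f M)`_0 = mxeval f (mxcoef 0 M).
Proof.
rewrite coef0_mmap; apply: meval_eq => i; exact: mxvec_coef.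
Qed.

Lemma coef1_mxpev f M :
  (mxpev f M)`_1 =
    \sum_i mxvec (mxcoef 1 M) 0 i * mxeval f^`M(i) (mxcoef 0 M).
Proof.
rewrite coef1_mmap; apply: eq_bigr => i _; rewrite mxvec_coef; congr (_ * _).
by apply: meval_eq => j; exact: mxvec_coef.
Qed.

Lemma mxdiff1E f M : mxcoef 0 M = 1%:M -> mxdiff1 f (mxcoef 1 M) = (mxpev f M)`_1.
Proof. by rewrite coef1_mxpev => ->. Qed.

Lemma mxdiff1_near f X : mxdiff1 f X = (mxpev f (near1 X))`_1.
Proof. by rewrite -mxdiff1E ?mxcoef0_near1 ?mxcoef1_near1. Qed.

Lemma horner_mxpev f M a : (mxpev f M).[a] = mxeval f (mxev a M).
Proof.
rewrite -[LHS]/(horner_eval a _) rmorph_mmap; apply: eq_bigr => m _ /=.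
congr (_ * _); first by rewrite /horner_eval hornerC.
by apply: eq_bigr => i _ /=; rewrite -map_mxvec !mxE.
Qed.

Lemma tangent1_curve (S : set 'M[k]_n) M :
  mxcoef 0 M = 1%:M -> (forall a, S (mxev a M)) -> tangent1 S (mxcoef 1 M).
Proof.
move=> M1 SM f fS; rewrite mxdiff1E // (_ : mxpev f M = 0) ?coef0 //.
by apply: poly_vanish => a; rewrite horner_mxpev fS.
Qed.

Definition mxgen : 'M[mxpol k n]_n := \matrix_(i, j) 'X_(mxvec_index i j).

Definition mxpC A : 'M[mxpol k n]_n := map_mx (@mpolyC _ k) A.

Definition mxpsubst f (Z : 'M[mxpol k n]_n) : mxpol k n :=
  mmap (@mpolyC _ k) (fun i => mxvec Z 0 i) f.

Let evalm A : {rmorphism mxpol k n -> k} := meval (mxvec A 0).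
Let pevm M : {rmorphism mxpol k n -> {poly k}} := mmap polyC (fun i => mxvec M 0 i).

Lemma evalm_gen A : map_mx (evalm A) mxgen = A.
Proof. by apply/matrixP => i j; rewrite !mxE /= mevalXU mxvecE. Qed.

Lemma evalm_mxpC A B : map_mx (evalm A) (mxpC B) = B.
Proof. by apply/matrixP => i j; rewrite !mxE /= mevalC. Qed.

Lemma pevm_gen M : map_mx (pevm M) mxgen = M.
Proof. by apply/matrixP => i j; rewrite !mxE /= mmapX mmap1U mxvecE. Qed.

Lemma pevm_mxpC M B : map_mx (pevm M) (mxpC B) = mxC B.
Proof. by apply/matrixP => i j; rewrite !mxE /= mmapC. Qed.

Lemma mxeval_subst f Z A : mxeval (mxpsubst f Z) A = mxeval f (map_mx (evalm A) Z).
Proof.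
rewrite -[LHS]/(evalm A _) rmorph_mmap; apply: eq_bigr => m _ /=.
congr (_ * _); first by rewrite mevalC.
by apply: eq_bigr => i _ /=; rewrite -map_mxvec !mxE.
Qed.

Lemma mxpev_subst f Z M : mxpev (mxpsubst f Z) M = mxpev f (map_mx (pevm M) Z).
Proof.
rewrite -[LHS]/(pevm M _) rmorph_mmap; apply: eq_bigr => m _ /=.
congr (_ * _); first by rewrite mmapC.
by apply: eq_bigr => i _ /=; rewrite -map_mxvec !mxE.
Qed.

Lemma mxC_mul m p q (A : 'M[k]_(m, p)) (B : 'M[k]_(p, q)) :
  mxC (A *m B) = mxC A *m mxC B.
Proof. exact: map_mxM. Qed.

Lemma mxC1 : mxC 1%:M = 1%:M :> 'M[{poly k}]_n.
Proof. exact: map_mx1. Qed.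

(** Pull [f] back along B |-> A B A^-1: the result still vanishes on [S], and 1 + tX is sent to 1 +
    t A X A^-1. *)
Lemma lie_conj (S : set 'M[k]_n) A X : A \in unitmx ->
  (forall B, S B -> S (A *m B *m invmx A)) ->
  X \in lie S -> A *m X *m invmx A \in lie S.
Proof.
move=> uA SA /lieP TX; apply/lieP => f fS.
pose Z := mxpC A *m mxgen *m mxpC (invmx A).
have := TX (mxpsubst f Z); rewrite !mxdiff1_near mxpev_subst.
rewrite /Z !map_mxM !pevm_mxpC pevm_gen /near1 mulmxDr mulmxDl mulmx1.
rewrite -!mxC_mul mulmxV // mxC1 -scalemxAr -scalemxAl -!mxC_mul; apply.
by move=> B SB; rewrite mxeval_subst !map_mxM !evalm_mxpC evalm_gen; apply/fS/SA.
Qed.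

Lemma lieS (S S' : set 'M[k]_n) : S `<=` S' -> (lie S <= lie S')%VS.
Proof.
move=> SS'; apply/subvP => X /lieP TX; apply/lieP => f fS.
by apply: TX => A /SS'; exact: fS.
Qed.

Lemma sum_sym_char2 (N : nat) (g : 'I_N -> 'I_N -> k) : 2%N \in [pchar k] ->
  (forall i j, g i j = g j i) -> (forall i, g i i = 0) ->
  \sum_i \sum_j g i j = 0.
Proof.
move=> ch2 gC g0; rewrite pair_big /=.
rewrite (bigID (fun p : 'I_N * 'I_N => (p.1 < p.2)%N)) /=.
rewrite [X in _ + X](bigID (fun p : 'I_N * 'I_N => (p.2 < p.1)%N)) /=.
rewrite [X in _ + (_ + X)]big1 => [|[i j] /=]; last first.
  rewrite -!leqNgt => ij; have /eqP/val_inj -> : (i == j :> nat); last exact: g0.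
  by rewrite eqn_leq andbC.
rewrite addr0 [X in _ + X](reindex_inj (h := fun p : 'I_N * 'I_N => (p.2, p.1))) /=;
  last by move=> [a b] [c d] [-> ->].
rewrite [X in _ + X](eq_big (fun p : 'I_N * 'I_N => (p.1 < p.2)%N)
  (fun p => g p.1 p.2)); first by rewrite addrr_pchar2.
  by move=> [i j] /=; case: ltngtP.
by move=> [i j] _; exact: gC.
Qed.

(** Two derivatives bring down a product of consecutive integers, which is even. *)
Lemma mderiv2_char2 (N : nat) i (f : {mpoly k[N]}) : 2%N \in [pchar k] ->
  f^`M(i)^`M(i) = 0.
Proof.
move=> ch2; apply/mpolyP => m; rewrite !mcoeff_deriv mcoeff0 -mulrnA.
rewrite -mulr_natr; suff -> : (((m + U_(i))%MM i).+1 * (m i).+1)%:R = 0 :> k.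
  by rewrite mulr0.
apply/eqP; rewrite -(dvdn_pcharf ch2) dvdn2 oddM mnmE mnm1E eqxx addn1 /=.
by case: odd.
Qed.

(* [D] is the left invariant derivation of X; in characteristic 2 its square *)
(* is again a derivation, the one of X^2.                                    *)
Lemma lie_sqr (S : set 'M[k]_n) X : 2%N \in [pchar k] ->
  S 1%:M -> (forall A B, S A -> S B -> S (A *m B)) ->
  X \in lie S -> X *m X \in lie S.
Proof.
move=> ch2 S1 SM /lieP TX; apply/lieP => f fS.
pose D := \sum_i mxvec (mxgen *m mxpC X) 0 i * f^`M(i).
(* The value of [D] at [A] is the differential along [X] of the left translate of [f] by [A], which
   also vanishes on [S]. *)
have DS A : S A -> mxeval D A = 0.
  move=> SA; have := TX (mxpsubst f (mxpC A *m mxgen)).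
  rewrite mxdiff1_near mxpev_subst map_mxM pevm_mxpC pevm_gen coef1_mxpev.
  rewrite !mxcoefMl mxcoef0_near1 mxcoef1_near1 mulmx1.
  rewrite -[mxeval D A]/(evalm A _) rmorph_sum => TXA; rewrite -[RHS]TXA; last first.
    by move=> B SB; rewrite mxeval_subst map_mxM evalm_mxpC evalm_gen; apply/fS/SM.
  apply: eq_bigr => i _; rewrite rmorphM; congr (_ * _).
  transitivity (map_mx (evalm A) (mxvec (mxgen *m mxpC X)) 0 i); first by rewrite mxE.
  by rewrite map_mxvec map_mxM evalm_mxpC evalm_gen.
have := TX D DS; rewrite mxdiff1_near -[mxpev D _]/(pevm (near1 X) _) rmorph_sum.
have pX i : pevm (near1 X) (mxvec (mxgen *m mxpC X) 0 i) =
    mxvec (near1 X *m mxC X) 0 i.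
  transitivity (map_mx (pevm (near1 X)) (mxvec (mxgen *m mxpC X)) 0 i).
    by rewrite mxE.
  by rewrite map_mxvec map_mxM pevm_mxpC pevm_gen.
rewrite coef_sum.
under eq_bigr => i _.
  rewrite rmorphM pX coefM big_ord_recl big_ord1 /= -/(mxpev _ _) coef0_mxpev.
  rewrite coef1_mxpev mxcoef0_near1 mxcoef1_near1.
  rewrite !mxvec_coef !mxcoefMr mxcoef0_near1 mxcoef1_near1 mul1mx mulr_sumr.
  over.
(* The second-order part is symmetric in the two indices with zero diagonal, so it cancels; what
   remains is the differential of [f] along X^2. *)
rewrite big_split /= sum_sym_char2 ?add0r // => [i j|i].
  by rewrite mderiv_comm mulrCA.
by rewrite mderiv2_char2 // /mxeval meval0 !mulr0.
Qed.

(** Polarization of [lie_sqr]: in characteristic 2 the bracket is the cross term of (X + Y)^2. *)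
Lemma lie_bracket (S : set 'M[k]_n) X Y : 2%N \in [pchar k] ->
  S 1%:M -> (forall A B, S A -> S B -> S (A *m B)) ->
  X \in lie S -> Y \in lie S -> X *m Y - Y *m X \in lie S.
Proof.
move=> ch2 S1 SM XS YS; have sq := lie_sqr ch2 S1 SM.
have -> : X *m Y - Y *m X = (X + Y) *m (X + Y) - X *m X - Y *m Y - Y *m X *+ 2.
  rewrite mulmxDl !mulmxDr mulr2n.
  move: (X *m X) (X *m Y) (Y *m X) (Y *m Y) => a b c d.
  by apply/matrixP => i j; rewrite !mxE; ring.
have -> : Y *m X *+ 2 = 0 by rewrite -scaler_nat (pcharf0 ch2) scale0r.
by rewrite subr0 !rpredB ?sq ?rpredD.
Qed.

(* The derivative of the adjugate at the identity in the direction X is       *)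
(* c%:M - X for some scalar c.                                                *)
Lemma lie_stab (S : set 'M[k]_n) (q : {vspace 'M[k]_n}) X :
  S `<=` [set A | A \in unitmx] ->
  (forall A Y, S A -> Y \in q -> A *m Y *m invmx A \in q) ->
  X \in lie S -> forall Y, Y \in q -> X *m Y - Y *m X \in q.
Proof.
move=> Su Sq /lieP TX Y Yq; apply/offP.
(* The adjugate replaces the inverse to keep the entries polynomial; the extra factor \det A is
   harmless since [q] is a subspace. *)
pose Z := mxgen *m mxpC Y *m \adj mxgen.
pose F i j : mxpol k n := \sum_r \sum_s (off q (delta_mx r s) i j)%:MP * Z r s.
have FE (R : comNzRingType) (h : {rmorphism mxpol k n -> R}) i j :
  h (F i j) = \sum_r \sum_s h (off q (delta_mx r s) i j)%:MP * map_mx h Z r s.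
  rewrite rmorph_sum; apply: eq_bigr => r _; rewrite rmorph_sum.
  by apply: eq_bigr => s _; rewrite rmorphM !mxE.
have offE W i j : off q W i j = \sum_r \sum_s off q (delta_mx r s) i j * W r s.
  rewrite [in LHS](matrix_sum_delta W) linear_sum summxE; apply: eq_bigr => r _.
  rewrite linear_sum summxE; apply: eq_bigr => s _.
  by rewrite linearZ mxE mulrC.
have FS i j A : S A -> mxeval (F i j) A = 0.
  move=> SA; rewrite -[LHS]/(evalm A _) FE.
  under eq_bigr do under eq_bigr do rewrite /= mevalC.
  rewrite -offE !map_mxM map_mx_adj evalm_gen evalm_mxpC.
  have -> : \adj A = \det A *: invmx A.
    by rewrite /invmx (Su _ SA) scalerA mulrV ?scale1r //; exact: (Su _ SA).
  have /offP E := Sq A Y SA Yq.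
  by rewrite -scalemxAr linearZ /= [X in \det A *: X]E scaler0 mxE.
apply/matrixP => i j; have := TX _ (FS i j).
rewrite mxdiff1_near -[mxpev _ _]/(pevm (near1 X) _) FE coef_sum.
under eq_bigr => r _.
  rewrite coef_sum; under eq_bigr => s _.
    rewrite /= mmapC coefCM !map_mxM map_mx_adj pevm_gen pevm_mxpC.
    have -> (P : 'M[{poly k}]_n) : (P r s)`_1 = mxcoef 1 P r s by rewrite mxE.
    over.
  over.
rewrite -offE mxE => <-; congr (fun_of_matrix _ i j).
set J := \adj (near1 X).
have JE : near1 X *m J = (\det (near1 X))%:M by exact: mul_mx_adj.
have J0 : mxcoef 0 J = 1%:M.
  rewrite -mxev0 /J /mxev map_mx_adj -/(mxev 0 _) mxev0 mxcoef0_near1.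
  by rewrite -[\adj _]mul1mx mul_mx_adj det1.
have J1 : mxcoef 1 J = ((\det (near1 X))`_1)%:M - X.
  have := congr1 (mxcoef 1) JE.
  rewrite mxcoefM big_ord_recl big_ord1 /= mxcoef0_near1 mxcoef1_near1 mul1mx.
  rewrite subn0 subnn J0 mulmx1 => /(canRL (addrK _)) ->; congr (_ - _).
  by apply/matrixP => r s; rewrite !mxE; case: (r == s); rewrite ?coef0.
rewrite mxcoefM big_ord_recl big_ord1 /= !mxcoefMr mxcoef0_near1 mxcoef1_near1.
rewrite mul1mx subn0 subnn J0 J1 mulmx1 mulmxBr mul_mx_scalar.
set c := (\det (near1 X))`_1; have E : off q (c *: Y) = 0.
  by apply/offP; rewrite rpredZ.
by rewrite -[RHS]/(off q _) -addrA [RHS]linearD [X in _ = X + _]E add0r addrC.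
Qed.

(** A linear form is its own differential. *)
Lemma lie_linear (S : set 'M[k]_n) (L : {linear 'M[k]_n -> 'M[k]_n}) X :
  (forall A, S A -> L A = 0) -> X \in lie S -> L X = 0.
Proof.
move=> LS /lieP TX; apply/matrixP => i j.
pose f : mxpol k n :=
  \sum_r \sum_s (L (delta_mx r s) i j)%:MP * 'X_(mxvec_index r s).
have LE W : L W i j = \sum_r \sum_s L (delta_mx r s) i j * W r s.
  rewrite [in LHS](matrix_sum_delta W) linear_sum summxE; apply: eq_bigr => r _.
  rewrite linear_sum summxE; apply: eq_bigr => s _.
  by rewrite linearZ mxE mulrC.
have := TX f; rewrite mxdiff1_near /mxpev rmorph_sum coef_sum => H.
rewrite [RHS]mxE -[RHS]H => [|A SA].
  rewrite LE; apply: eq_bigr => r _; rewrite rmorph_sum coef_sum.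
  apply: eq_bigr => s _; rewrite rmorphM /= mmapC mmapX mmap1U mxvecE coefCM.
  by rewrite -[in LHS](mxcoef1_near1 X) [in LHS]mxE.
transitivity (L A i j); last by rewrite LS // mxE.
rewrite LE -[LHS]/(evalm A _) rmorph_sum; apply: eq_bigr => r _.
rewrite rmorph_sum; apply: eq_bigr => s _.
by rewrite rmorphM /= mevalC mevalXU mxvecE.
Qed.

End Calculus.

(** * SL_2 in characteristic 2 *)

Section RootSubgroups.
Variable k : closedFieldType.
Hypothesis ch2 : 2%N \in [pchar k].

Lemma mxoppE m n (A : 'M[k]_(m, n)) : - A = A.
Proof. by apply/matrixP => i j; rewrite mxE oppr_pchar2. Qed.

Lemma mxaddA m n (A : 'M[k]_(m, n)) : A + A = 0.
Proof. by rewrite -[X in X + _]mxoppE addNr. Qed.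

(* The commutator in characteristic 2. It is locked, since rpredD would       *)
(* otherwise split a bracket into its two summands.                           *)
Fact br_key : unit. Proof. by []. Qed.

Definition br n (X Y : 'M[k]_n) : 'M[k]_n := locked_with br_key (X *m Y + Y *m X).

Lemma brE n (X Y : 'M[k]_n) : br X Y = X *m Y + Y *m X.
Proof. by rewrite /br unlock. Qed.

Lemma br_commutator n (X Y : 'M[k]_n) : X *m Y - Y *m X = br X Y.
Proof. by rewrite mxoppE brE. Qed.

Lemma brC n (X Y : 'M[k]_n) : br X Y = br Y X.
Proof. by rewrite !brE addrC. Qed.

Lemma brDr n (X Y Z : 'M[k]_n) : br X (Y + Z) = br X Y + br X Z.
Proof. by rewrite !brE mulmxDr mulmxDl addrACA. Qed.

Lemma brZr n c (X Y : 'M[k]_n) : br X (c *: Y) = c *: br X Y.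
Proof. by rewrite !brE -scalemxAr -scalemxAl scalerDr. Qed.

Lemma brDl n (X Y Z : 'M[k]_n) : br (Y + Z) X = br Y X + br Z X.
Proof. by rewrite brC brDr !(brC X). Qed.

Lemma brZl n c (X Y : 'M[k]_n) : br (c *: Y) X = c *: br Y X.
Proof. by rewrite brC brZr (brC X). Qed.

Lemma br0r n (X : 'M[k]_n) : br X 0 = 0.
Proof. by rewrite !brE mulmx0 mul0mx addr0. Qed.

Lemma brJ n (X Y Z : 'M[k]_n) : br X (br Y Z) = br (br X Y) Z + br Y (br X Z).
Proof.
rewrite !brE !mulmxDr !mulmxDl !mulmxA.
move: (X *m Y *m Z) (X *m Z *m Y) (Y *m Z *m X) (Z *m Y *m X) (Y *m X *m Z)
  (Z *m X *m Y) => a b c d e f.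
have e0 := mxaddA e; have f0 := mxaddA f.
have -> : a + b + (c + d) = (e + e) + (f + f) + (a + b + (c + d)).
  by rewrite e0 f0 !add0r.
by apply/matrixP => i j; rewrite !mxE; ring.
Qed.

Lemma mx2P (A B : 'M[k]_2) : A 0 0 = B 0 0 -> A 0 1 = B 0 1 ->
  A 1 0 = B 1 0 -> A 1 1 = B 1 1 -> A = B.
Proof.
move=> e00 e01 e10 e11; apply/matrixP => i j.
have I2 (x : 'I_2) : x = 0 \/ x = 1.
  by case: x => [[|[|]] //= ?]; [left|right]; apply/val_inj.
by case: (I2 i) (I2 j) => -> [] ->.
Qed.

Lemma mul2E (A B : 'M[k]_2) i j : (A *m B) i j = A i 0 * B 0 j + A i 1 * B 1 j.
Proof.
by rewrite mxE !big_ord_recl big_ord0 addr0; congr (_ + A _ _ * B _ _); apply/val_inj.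
Qed.

Let e01 : (0 == 1 :> 'I_2) = false. Proof. by []. Qed.
Let e10 : (1 == 0 :> 'I_2) = false. Proof. by []. Qed.

Definition entry2E := (mul2E, mxE, eqxx, e01, e10, mulr1n, mulr0n,
  andbT, andbF, andTb, andFb, mulr0, mul0r, mulr1, mul1r, add0r, addr0).

Lemma upper2M (a b : k) : upper2 a *m upper2 b = upper2 (a + b).
Proof.
by apply: mx2P; rewrite !entry2E //= addrC.
Qed.

Lemma det_2 (A : 'M[k]_2) : \det A = A 0 0 * A 1 1 - A 0 1 * A 1 0.
Proof.
rewrite (expand_det_row _ 0) !big_ord_recl big_ord0 /cofactor !det_mx11 !mxE /=.
rewrite addr0 expr0 mul1r expr1 mulN1r mulrN.
by congr (_ * A _ _ - A _ _ * A _ _); apply/val_inj.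
Qed.

(** In characteristic 2 this representative of the Weyl element has determinant 1 and is an
    involution, so no signs enter. *)
Definition swap2 : 'M[k]_2 := delta_mx 0 1 + delta_mx 1 0.

Lemma SL2_upper (a : k) : SL2 (upper2 a).
Proof. by rewrite /SL2 /= det_2 !entry2E /=; ring. Qed.

Lemma SL2_lower (a : k) : SL2 (lower2 a).
Proof. by rewrite /SL2 /= det_2 !entry2E /=; ring. Qed.

Lemma SL2_diag (c : k) : c != 0 -> SL2 (diag2 c).
Proof. by move=> c0; rewrite /SL2 /= det_2 !entry2E /=; field. Qed.

Lemma SL2_swap : SL2 swap2.
Proof. by rewrite /SL2 /= det_2 !entry2E /= oppr_pchar2 //; ring. Qed.

Lemma SL2_mul (A B : 'M[k]_2) : SL2 A -> SL2 B -> SL2 (A *m B).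
Proof. by rewrite /SL2 /= det_mulmx => -> ->; rewrite mulr1. Qed.

Lemma swap2K : swap2 *m swap2 = 1%:M.
Proof.
by apply: mx2P; rewrite !entry2E /=; ring.
Qed.

Lemma diag2K (c : k) : c != 0 -> diag2 c *m diag2 c^-1 = 1%:M.
Proof.
move=> c0.
by apply: mx2P; rewrite !entry2E /= ?divff ?invr_eq0.
Qed.

Lemma swap2E : swap2 = upper2 1 *m lower2 1 *m upper2 1.
Proof.
have c1 : 1 + 1 = 0 :> k by rewrite addrr_pchar2.
by apply: mx2P; rewrite !entry2E /= ?c1 ?entry2E.
Qed.

Lemma swap2_torus (c : k) : c != 0 ->
  upper2 c *m lower2 c^-1 *m upper2 c = swap2 *m diag2 c^-1.
Proof.
move=> c0; have c1 : 1 + 1 = 0 :> k by rewrite addrr_pchar2.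
have cc x : x + x = 0 :> k by rewrite addrr_pchar2.
by apply: mx2P; rewrite !entry2E ?invrK ?divff ?mulVf ?invr_eq0 // ?c1 ?entry2E ?cc.
Qed.

Lemma upper2_bruhat (a : k) : a != 0 ->
  upper2 a = lower2 a^-1 *m swap2 *m diag2 a^-1 *m lower2 a^-1.
Proof.
move=> a0; have c1 : 1 + 1 = 0 :> k by rewrite addrr_pchar2.
have cc x : x + x = 0 :> k by rewrite addrr_pchar2.
by apply: mx2P; rewrite !entry2E ?invrK ?divff ?mulVf ?invr_eq0 // ?c1 ?entry2E ?cc.
Qed.

End RootSubgroups.

(** * Root vectors and root strings *)

Section Realization.
Variables (k : closedFieldType) (n : nat) (G T : set 'M[k]_n).
Variables (alpha1 alpha2 : 'M[k]_n -> k) (phi : int * int -> 'M[k]_2 -> 'M[k]_n).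
Hypothesis ch2 : 2%N \in [pchar k].
Hypothesis sgG : subgroup G.
Hypothesis sgT : subgroup T.
Hypothesis TG : T `<=` G.
Hypothesis Tab : forall s t, T s -> T t -> s *m t = t *m s.
Hypothesis real : G2_realization G T alpha1 alpha2 phi.

Local Notation R := G2_roots.
Local Notation wt := (wt alpha1 alpha2).

Lemma G_unit A : G A -> A \in unitmx.
Proof. by case: sgG => H _ _ _; exact: H. Qed.

Lemma phi_G g A : g \in R -> SL2 A -> G (phi g A).
Proof. by move=> gR; case: (G2_phi_morph real gR) => _ H _; exact: H. Qed.

Lemma phiM g A B : g \in R -> SL2 A -> SL2 B -> phi g (A *m B) = phi g A *m phi g B.
Proof. by move=> gR; case: (G2_phi_morph real gR) => _ _ H; exact: H. Qed.

Lemma SL2_1 : SL2 (1%:M : 'M[k]_2).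
Proof. exact: det1. Qed.

Lemma phi1 g : g \in R -> phi g 1%:M = 1%:M.
Proof.
move=> gR; have u := G_unit (phi_G gR SL2_1).
have := phiM gR SL2_1 SL2_1; rewrite mul1mx => /(congr1 (mulmx (invmx (phi g 1%:M)))).
by rewrite mulmxA mulVmx // mul1mx.
Qed.

Lemma invmx_uniq (A B : 'M[k]_n) : A *m B = 1%:M -> invmx A = B.
Proof.
move=> AB; have [uA _] := mulmx1_unit AB.
by rewrite -[LHS]mulmx1 -AB mulmxA mulVmx // mul1mx.
Qed.

Lemma phi_inv g A B : g \in R -> SL2 A -> SL2 B -> A *m B = 1%:M ->
  invmx (phi g A) = phi g B.
Proof. by move=> gR sA sB AB; apply: invmx_uniq; rewrite -phiM // AB phi1. Qed.

Lemma upper2_0 : upper2 0 = 1%:M :> 'M[k]_2.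
Proof. by rewrite /upper2 scale0r addr0. Qed.

Lemma phi_upper_inv g a : g \in R -> invmx (phi g (upper2 a)) = phi g (upper2 a).
Proof.
move=> gR; apply: phi_inv => //; try exact: SL2_upper.
by rewrite upper2M addrr_pchar2 // upper2_0.
Qed.

Lemma rootsN g : g \in R -> - g \in R.
Proof. by rewrite !inE; do !case/predU1P => [-> //|]; move/eqP=> ->. Qed.

(** [phi g] is regular on [SL2], where the determinant denominators are 1, and [upper2 a] is itself
    a polynomial curve. *)
Lemma exists_root_poly g : g \in R ->
  exists U : 'M[{poly k}]_n, forall a, mxev a U = phi g (upper2 a).
Proof.
move=> gR; case: (G2_phi_morph real gR) => rm _ _.
have /choice [p Hp] : forall ij : 'I_n * 'I_n, exists p : mxpol k 2,
    forall A, SL2 A -> phi g A ij.1 ij.2 = mxeval p A.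
  move=> [i j]; have [p [e H]] := rm i j; exists p => A sA.
  by rewrite H // (sA : \det A = 1) expr1n divr1.
exists (\matrix_(i, j) mxpev (p (i, j)) (near1 (delta_mx 0 1))) => a.
apply/matrixP => i j; rewrite !mxE /horner_eval horner_mxpev.
rewrite (Hp (i, j)); last exact: SL2_upper.
by rewrite /near1 mxevD mxev_scale mxevC hornerX -mxC1 mxevC.
Qed.

Definition rpoly g : 'M[{poly k}]_n :=
  xget 0 [set U | forall a, mxev a U = phi g (upper2 a)].

Lemma rpolyE g a : g \in R -> mxev a (rpoly g) = phi g (upper2 a).
Proof. by move=> gR; have /xgetPex := exists_root_poly gR; apply. Qed.

Definition rvec g : 'M[k]_n := mxcoef 1 (rpoly g).

Lemma rpoly0 g : g \in R -> mxcoef 0 (rpoly g) = 1%:M.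
Proof. by move=> gR; rewrite -mxev0 rpolyE // upper2_0 phi1. Qed.

Lemma rpolyM g a b : g \in R ->
  mxev a (rpoly g) *m mxev b (rpoly g) = mxev (a + b) (rpoly g).
Proof.
by move=> gR; rewrite !rpolyE // -upper2M phiM //; exact: SL2_upper.
Qed.

Lemma rpolyK g : g \in R -> rpoly g *m rpoly g = 1%:M.
Proof.
move=> gR; rewrite -mxC1; apply: mxev_inj => a.
by rewrite mxev_mul rpolyM // mxevC addrr_pchar2 // mxev0 rpoly0.
Qed.

(** In degree 2, x_g(a) x_g(a) = 1 reads 2 P_2 + e_g^2 = 0, and the first term is zero. *)
Lemma rvec_sqr g : g \in R -> rvec g *m rvec g = 0.
Proof.
move=> gR; have := congr1 (mxcoef 2) (rpolyK gR).
rewrite mxcoefM !big_ord_recl big_ord0 /= rpoly0 // mul1mx mulmx1 addr0.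
rewrite -mxC1 mxcoefC /= addrCA subn0 -[bump 0 (bump 0 0)]/2%N -[bump 0 0]/1%N.
by rewrite -[(2 - 1)%N]/1%N mxaddA // addr0.
Qed.

Lemma coef1_expr (P : {poly k}) l : P`_0 = 0 -> (P ^+ l)`_1 = (l == 1%N)%:R * P`_1.
Proof.
move=> P0; case: l => [|l]; first by rewrite expr0 coef1 mul0r.
rewrite exprS coefM big_ord_recl big_ord1 /= P0 mul0r add0r mulrC; congr (_ * _).
by rewrite subnn -horner_coef0 horner_exp horner_coef0 P0 expr0n eqSS.
Qed.

Lemma det_rpoly g : g \in R -> \det (rpoly g) = 1.
Proof.
move=> gR; have /eqP := congr1 determinant (rpolyK gR).
rewrite det_mulmx det1 -expr2 sqrf_eq1 => /orP[] /eqP -> //.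
by rewrite -polyC1 -polyCN oppr_pchar2.
Qed.

Lemma rpoly_retract g : g \in R ->
  exists p : mxpol k n, forall a, mxeval p (phi g (upper2 a)) = a.
Proof.
move=> gR; have [psi [p [e H]] psiK] := G2_phi_iso real gR; exists p => a.
rewrite -[RHS]psiK H; last by exists a.
rewrite -rpolyE // (_ : \det _ = 1) ?expr1n ?divr1 //.
by rewrite /mxev det_map_mx det_rpoly // rmorph1.
Qed.

(** A polynomial retraction composed with the curve x_g is the identity of k, whose derivative is 1;
    so the velocity of the curve is nonzero. *)
Lemma rvec_neq0 g : g \in R -> rvec g != 0.
Proof.
move=> gR; have [p pK] := rpoly_retract gR; apply/eqP => r0.
have := mxdiff1E p (rpoly0 gR); rewrite -/(rvec g) r0 /mxdiff1 big1 => [|i _].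
  rewrite (_ : mxpev _ _ = 'X); first by rewrite coefX /= => /esym/eqP; rewrite oner_eq0.
  apply/eqP; rewrite -subr_eq0; apply/eqP/poly_vanish => a.
  by rewrite hornerD hornerN horner_mxpev rpolyE // pK hornerX subrr.
by rewrite linear0 mxE mul0r.
Qed.

(** With a retraction [p], each entry X_ij minus the polynomial in [p] that gives this entry of x_g
    vanishes on the root subgroup. Its differential forces a tangent vector [X] to equal dp(X) times
    [rvec g]. *)
Lemma lie_root g : g \in R -> lie (root_subgroup phi g) = <[rvec g]>%VS.
Proof.
move=> gR; apply/eqP; rewrite eqEsubv; apply/andP; split; last first.
  rewrite -memvE; apply/lieP/tangent1_curve => [|a]; first exact: rpoly0.
  by rewrite rpolyE //; exists a.
apply/subvP => X /lieP TX; have [p pK] := rpoly_retract gR.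
apply/vlineP; exists (mxdiff1 p X).
(* At least 2, so that the linear coefficient occurs in the sum. *)
apply/matrixP => i j; pose N := maxn 2 (mxdeg (rpoly g)).
pose f : mxpol k n := mxgen k n i j -
  \sum_(l < N) (mxcoef l (rpoly g) i j)%:MP * p ^+ l.
have fE M : mxpev f M = M i j - \sum_(l < N) (mxcoef l (rpoly g) i j)%:P * mxpev p M ^+ l.
  rewrite /mxpev rmorphB rmorph_sum; congr (_ - _).
    by rewrite mxE /= mmapX mmap1U mxvecE.
  by apply: eq_bigr => l _; rewrite rmorphM rmorphXn /= mmapC.
have fS A : root_subgroup phi g A -> mxeval f A = 0.
  case=> a _ <-; rewrite -rpolyE // -horner_mxpev fE hornerD hornerN horner_sum.
  apply/eqP; rewrite subr_eq0; apply/eqP.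
  transitivity (mxev a (rpoly g) i j); first by rewrite mxE.
  rewrite (@mxev_sum _ _ _ _ N) ?leq_maxr // summxE; apply: eq_bigr => l _.
  by rewrite mxE hornerM hornerC horner_exp horner_mxpev rpolyE // pK mulrC.
have P0 : (mxpev p (near1 X))`_0 = 0.
  by rewrite coef0_mxpev mxcoef0_near1 -(phi1 gR) -upper2_0 pK.
have := TX f fS; rewrite mxdiff1_near fE coefB coef_sum => /eqP.
rewrite subr_eq0 => /eqP H; transitivity ((near1 X i j)`_1).
  by rewrite -[in LHS](mxcoef1_near1 X) mxE.
have N1 : (1 < N)%N by rewrite leq_max.
rewrite {}H (bigD1 (Ordinal N1)) //= big1 => [|l /negbTE l1].
  by rewrite coefCM addr0 expr1 -mxdiff1_near !mxE mulrC.
by rewrite coefCM coef1_expr // (l1 : (val l == 1%N) = false) mul0r mulr0.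
Qed.

(** * Weights of T and the adjoint action of root subgroups *)

Lemma character_neq0 chi t : character T chi -> T t -> chi t != 0.
Proof.
case=> _ chi1 chiM Tt; apply/eqP => c0; case: sgT => _ _ _ /(_ t Tt) Ti.
have := chiM _ _ Tt Ti; rewrite mulmxV ?(G_unit (TG Tt)) // c0 mul0r chi1 => /eqP.
by rewrite oner_eq0.
Qed.

Lemma wt_neq0 g t : T t -> wt g t != 0.
Proof.
move=> Tt; have a1 := character_neq0 (G2_char1 real) Tt.
have a2 := character_neq0 (G2_char2 real) Tt.
by rewrite mulf_neq0 ?expfz_neq0.
Qed.

Lemma wtD g h t : T t -> wt (g + h) t = wt g t * wt h t.
Proof.
move=> Tt; have a1 := character_neq0 (G2_char1 real) Tt.
have a2 := character_neq0 (G2_char2 real) Tt.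
by rewrite /Defs.wt /= !expfzDr // mulrACA.
Qed.

Lemma wt0 t : wt 0 t = 1.
Proof. by rewrite /Defs.wt /= !expr0z mulr1. Qed.

Lemma wtMn g i t : T t -> wt (g *+ i) t = wt g t ^+ i.
Proof.
move=> Tt; elim: i => [|i IH]; first by rewrite mulr0n wt0.
by rewrite mulrS wtD // IH exprS.
Qed.

Lemma wtN g t : T t -> wt (- g) t = (wt g t)^-1.
Proof.
move=> Tt; apply: (mulfI (wt_neq0 g Tt)).
by rewrite -wtD // addrN wt0 divff ?wt_neq0.
Qed.

Definition cartan1 (g : int * int) : int := g.1 * 2 - g.2 * 3.
Definition cartan2 (g : int * int) : int := g.2 * 2 - g.1.

Lemma wt_coroot1 g c : c != 0 -> wt g (phi (1, 0) (diag2 c)) = c ^ cartan1 g.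
Proof.
move=> c0; have [e1 e2 _ _] := G2_cartan real c0.
rewrite /Defs.wt e1 e2 !exprz_exp -expfzDr //; congr (_ ^ _).
by rewrite /cartan1; ring.
Qed.

Lemma wt_coroot2 g c : c != 0 -> wt g (phi (0, 1) (diag2 c)) = c ^ cartan2 g.
Proof.
move=> c0; have [_ _ e1 e2] := G2_cartan real c0.
rewrite /Defs.wt e1 e2 !exprz_exp -expfzDr //; congr (_ ^ _).
by rewrite /cartan2; ring.
Qed.

(** A weight is determined by its pairings with the two simple coroots, the Cartan matrix being
    invertible, and these exponents are visible on the values in k^*. *)
Lemma wt_sep g h : g <> h -> exists2 t, T t & wt g t != wt h t.
Proof.
move=> gh; apply: contrapT => no.
have e t : T t -> wt g t = wt h t.
  by move=> Tt; apply: contrapT => /eqP ne; apply: no; exists t.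
have e1 : cartan1 g = cartan1 h.
  apply: (@exprz_inj k) => c c0; rewrite -!wt_coroot1 //; apply: e.
  exact: (G2_coroot real).
have e2 : cartan2 g = cartan2 h.
  apply: (@exprz_inj k) => c c0; rewrite -!wt_coroot2 //; apply: e.
  exact: (G2_coroot real).
apply: gh; rewrite [g]surjective_pairing [h]surjective_pairing.
by move: e1 e2; rewrite /cartan1 /cartan2 => e1 e2; congr (_, _); lia.
Qed.

Definition weight g X := weight_vector T (wt g) X.

Lemma weightZ g c X : weight g X -> weight g (c *: X).
Proof. by move=> wX t Tt; rewrite -scalemxAr -scalemxAl wX // !scalerA mulrC. Qed.

Lemma weightB g X Y : weight g X -> weight g Y -> weight g (X - Y).
Proof.
by move=> wX wY t Tt; rewrite mulmxBr mulmxBl wX // wY // scalerBr.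
Qed.

Lemma T_unit t : T t -> t \in unitmx.
Proof. by move=> Tt; apply/G_unit/TG. Qed.

Lemma conj_mul t (U V : 'M[k]_n) : t \in unitmx ->
  t *m (U *m V) *m invmx t = (t *m U *m invmx t) *m (t *m V *m invmx t).
Proof.
by move=> ut; rewrite !mulmxA; congr (_ *m _ *m _); rewrite -!mulmxA mulVmx // mulmx1.
Qed.

Lemma weight_br g h X Y : weight g X -> weight h Y -> weight (g + h) (br X Y).
Proof.
move=> wX wY t Tt; have ut := T_unit Tt.
rewrite !brE mulmxDr mulmxDl !conj_mul // wX // wY // -!scalemxAr -!scalemxAl !scalerA.
by rewrite wtD // [wt h t * _]mulrC -scalerDr.
Qed.

Lemma weight_lieT X : X \in lie T -> weight 0 X.
Proof.
move=> XT t Tt; rewrite wt0 scale1r.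
suff /eqP : (mulmx t \- mulmxr t) X = 0.
  by rewrite /= subr_eq0 => /eqP ->; rewrite -mulmxA mulmxV ?mulmx1 ?T_unit.
by apply: lie_linear XT => A TA /=; rewrite Tab // subrr.
Qed.

(** Conjugation by [t] rescales the parameter of the curve by [wt g t], hence its coefficient [i] by
    the power [i]. *)
Lemma weight_mxscale g U P : (forall t a, T t -> 
   t *m mxev a P *m invmx t = U t *: mxev (wt g t * a) P) ->
  forall i t, T t -> t *m mxcoef i P *m invmx t = (wt g t ^+ i * U t) *: mxcoef i P.
Proof.
move=> H i t Tt; pose Q := map_mx (fun p : {poly k} => p \Po (wt g t *: 'X)) P.
have QE : mxC t *m P *m mxC (invmx t) = (U t)%:P *: Q.
  apply: mxev_inj => a; rewrite !mxev_mul !mxevC H // mxev_scale hornerC.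
  congr (_ *: _); apply/matrixP => r s; rewrite !mxE /horner_eval horner_comp.
  by rewrite hornerZ hornerX.
have := congr1 (mxcoef i) QE; rewrite mxcoefMr mxcoefMl => ->.
apply/matrixP => r s; rewrite !mxE coefCM -[RHS]mulrA mulrCA; congr (_ * _).
rewrite comp_polyE coef_sum.
under eq_bigr do rewrite exprZn coefZ coefZ coefXn.
have [le|lt] := ltnP i (size (P r s)).
  rewrite (bigD1 (Ordinal le)) //= eqxx big1 ?addr0 => [|j /negbTE ji].
    by rewrite mulr1 mulrC.
  by rewrite eq_sym (ji : (val j == i) = false) !mulr0.
rewrite nth_default // mulr0 big1 // => j _.
by rewrite (gtn_eqF (leq_trans (ltn_ord j) lt)) !mulr0.
Qed.

Lemma weight_rvec g : g \in R -> weight g (rvec g).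
Proof.
move=> gR t Tt; rewrite (@weight_mxscale g (fun=> 1)) // => [|s a Ts].
  by rewrite expr1 mulr1.
by rewrite !rpolyE // scale1r (G2_phi_conj real).
Qed.

(* The two factors are mutually inverse in characteristic 2: this is Ad(x_g) v. *)
Definition rAd g v : 'M[{poly k}]_n := rpoly g *m mxC v *m rpoly g.

Lemma rAdE g v a : g \in R ->
  mxev a (rAd g v) = phi g (upper2 a) *m v *m phi g (upper2 a).
Proof. by move=> gR; rewrite !mxev_mul mxevC rpolyE. Qed.

Lemma rAd_coef0 g v : g \in R -> mxcoef 0 (rAd g v) = v.
Proof.
by move=> gR; rewrite -mxev0 rAdE // upper2_0 phi1 // mul1mx mulmx1.
Qed.

Lemma rAd_coef1 g v : g \in R -> mxcoef 1 (rAd g v) = br (rvec g) v.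
Proof.
move=> gR; rewrite mxcoefM big_ord_recl big_ord1 /= subn0 subnn.
by rewrite !mxcoefMr rpoly0 // mul1mx mulmx1 !brE addrC.
Qed.

Lemma rAdD g u v : rAd g (u + v) = rAd g u + rAd g v.
Proof. by rewrite /rAd /mxC map_mxD mulmxDr mulmxDl. Qed.

Lemma rAd_shift g v a b : g \in R ->
  mxev a (rAd g (mxev b (rAd g v))) = mxev (a + b) (rAd g v).
Proof.
move=> gR; rewrite !rAdE // -upper2M phiM //; try exact: SL2_upper.
rewrite {2}(_ : phi g (upper2 a) *m phi g (upper2 b) =
  phi g (upper2 b) *m phi g (upper2 a)) ?mulmxA //.
by rewrite -!phiM ?upper2M 1?addrC //; exact: SL2_upper.
Qed.

(** The differential equation F' = [e_g, F] of F(a) = Ad(x_g(a)) v, from the one-parameter law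
    [rAd_shift]. In characteristic 2 its left side vanishes for odd [i]. *)
Lemma rAd_deriv g v i : g \in R ->
  mxcoef i.+1 (rAd g v) *+ i.+1 = br (rvec g) (mxcoef i (rAd g v)).
Proof.
move=> gR; set F := rAd g v.
have dF : map_mx (@deriv k) F = mxC (rvec g) *m F + F *m mxC (rvec g).
  apply: mxev_inj => a; rewrite mxevD (mxev_mul a _ F) (mxev_mul a F) mxevC.
  rewrite -brE -rAd_coef1 //.
  have -> : rAd g (mxev a F) = map_mx (fun p : {poly k} => p \Po ('X + a%:P)) F.
    apply: mxev_inj => b; rewrite rAd_shift //.
    apply/matrixP => r s; rewrite !mxE /horner_eval horner_comp.
    by rewrite hornerD hornerX hornerC.
  apply/matrixP => r s; rewrite !mxE /horner_eval.
  rewrite -[RHS]mulr1n -[X in _ *+ X]/(0.+1)%N -coef_deriv -horner_coef0 deriv_comp.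
  by rewrite derivD derivX derivC addr0 mulr1 horner_comp hornerD hornerX hornerC add0r.
have := congr1 (mxcoef i) dF; rewrite mxcoefD mxcoefMr mxcoefMl -brE => <-.
by apply/matrixP => r s; rewrite mulmxnE !mxE coef_deriv.
Qed.

(** Ad(x_g(a)) commutes with ad e_g, because x_g(a) commutes with x_g(b) and e_g is a coefficient of
    the latter. *)
Lemma rAd_br g v i : g \in R ->
  mxcoef i (rAd g (br (rvec g) v)) = br (rvec g) (mxcoef i (rAd g v)).
Proof.
move=> gR; have uE : rpoly g *m mxC (rvec g) = mxC (rvec g) *m rpoly g.
  apply: mxev_inj => a; rewrite !mxev_mul mxevC.
  have := congr1 (mxcoef 1) (_ : mxC (mxev a (rpoly g)) *m rpoly g =
     rpoly g *m mxC (mxev a (rpoly g))); rewrite mxcoefMr mxcoefMl; apply.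
  by apply: mxev_inj => b; rewrite !mxev_mul !mxevC !rpolyM // addrC.
rewrite [in RHS]brE -mxcoefMl -mxcoefMr -mxcoefD; congr (mxcoef i _).
rewrite /rAd !brE /mxC map_mxD mulmxDr mulmxDl -!/(mxC _) !mxC_mul !mulmxA uE.
by rewrite -!mulmxA uE.
Qed.

Lemma weight_rAd g h v i : g \in R -> weight h v ->
  weight (h + g *+ i) (mxcoef i (rAd g v)).
Proof.
move=> gR wv t Tt.
rewrite (@weight_mxscale g (wt h)) //; first by rewrite wtD // wtMn // mulrC.
move=> s a Ts; have us := T_unit Ts; rewrite !rAdE // !conj_mul //.
by rewrite !(G2_phi_conj real) // wv // -scalemxAr -scalemxAl.
Qed.

Lemma rAd_lieG g v i : g \in R -> v \in lie G -> mxcoef i (rAd g v) \in lie G.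
Proof.
move=> gR vG; apply: mxcoef_mem => a.
rewrite rAdE // -[X in _ *m X]phi_upper_inv //; have Gu := phi_G gR (SL2_upper a).
apply: lie_conj => // [|B GB]; first exact: G_unit.
by case: sgG => _ _ GM GV; apply: (GM); [exact: GM|exact: GV].
Qed.

(** Linear independence of characters: for [t] separating [g] from the head [d], the operator Ad(t)
    - [wt d t] kills the summand at [d] and scales the sum by a nonzero factor. *)
Lemma weight_indep (D : seq (int * int)) (x : int * int -> 'M[k]_n) g :
  (forall h, h \in D -> weight h (x h)) -> g \notin D ->
  weight g (\sum_(h <- D) x h) -> \sum_(h <- D) x h = 0.
Proof.
elim: D x => [|d D IH] x wx; first by rewrite big_nil.
rewrite inE negb_or => /andP[/eqP gd gD]; set s := \sum_(h <- _) _ => ws.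
have [t Tt ne] := wt_sep gd.
have E : (wt g t - wt d t) *: s = \sum_(h <- D) (wt h t - wt d t) *: x h.
  rewrite scalerBl -ws // /s mulmx_sumr mulmx_suml scaler_sumr -sumrB big_cons.
  rewrite wx ?mem_head // subrr add0r; apply: eq_big_seq => h hD.
  by rewrite wx ?inE ?hD ?orbT // scalerBl.
have : (wt g t - wt d t) *: s = 0.
  rewrite E; apply: IH => // [h hD|]; last by rewrite -E; apply: weightZ.
  by apply/weightZ/wx; rewrite inE hD orbT.
by move/eqP; rewrite scaler_eq0 subr_eq0 (negbTE ne) => /eqP.
Qed.

(** * Weight decomposition of Lie G *)

Definition wsp (P : pred (int * int)) : {vspace 'M[k]_n} :=
  (lie T + \sum_(g <- R | P g) <[rvec g]>)%VS.

Lemma lieG_wsp : lie G = wsp predT.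
Proof.
rewrite (G2_lie_decomposition real) /wsp; congr (_ + _)%VS.
by apply: eq_big_seq => g gR; rewrite lie_root.
Qed.

(** The coefficients run over all of [R] and vanish off [P], so spaces for different [P] share the
    same coordinates. *)
Lemma wspP P X : X \in wsp P <-> exists2 t, t \in lie T &
  exists2 c, (forall g, ~~ P g -> c g = 0) & X = t + \sum_(g <- R) c g *: rvec g.
Proof.
split=> [|[t tT [c cP ->]]]; last first.
  apply: memv_add => //; elim: (R) => [|d D IH]; first by rewrite !big_nil mem0v.
  rewrite !big_cons; case: ifPn => [_|/cP ->]; last by rewrite scale0r add0r.
  by rewrite memv_add // rpredZ // memv_line.
move=> /memv_addP [t tT [Y YD ->]]; exists t => //.
suff [c cP ->] : exists2 c, (forall g, ~~ P g -> c g = 0) &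
  Y = \sum_(g <- R) c g *: rvec g by exists c.
have : uniq R by []; elim: (R) Y YD => [|d D IH] Y.
  by rewrite big_nil memv0 => /eqP -> _; exists (fun=> 0) => //; rewrite big_nil.
rewrite big_cons /= => YD /andP[dD uD].
have [a [Z ZD [aP ->]]] : exists a, exists2 Z,
    Z \in (\sum_(j <- D | P j) <[rvec j]>)%VS & (~~ P d -> a = 0) /\ Y = a *: rvec d + Z.
  case: ifP YD => [_ /memv_addP [_ /vlineP[a ->] [Z ZD ->]]|_ YD].
    by exists a; exists Z.
  by exists 0; exists Y => //; rewrite scale0r add0r.
have [c cP ->] := IH _ ZD uD.
exists (fun g => if g == d then a else c g) => [g|].
  by case: eqP => [->|_]; [exact: aP|exact: cP].
rewrite big_cons eqxx; congr (_ + _); apply: eq_big_seq => g gD.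
by case: eqP => // gd; rewrite -gd gD in dD.
Qed.

Lemma weight_comp t c g : t \in lie T ->
  weight g (t + \sum_(h <- R) c h *: rvec h) ->
  t + \sum_(h <- R) c h *: rvec h =
    if g == 0 then t else if g \in R then c g *: rvec g else 0.
Proof.
move=> tT; pose x h := if h == 0 then t else c h *: rvec h.
have -> : t + \sum_(h <- R) c h *: rvec h = \sum_(h <- 0 :: R) x h.
  rewrite [RHS]big_cons {1}/x eqxx; congr (_ + _); apply: eq_big_seq => h hR.
  by rewrite /x; case: eqP => // h0; rewrite h0 in hR.
have wx h : h \in 0 :: R -> weight h (x h).
  rewrite inE /x; case: eqP => [-> _|_ /= hR]; first exact: weight_lieT.
  exact/weightZ/weight_rvec.
have [gD|gD] := boolP (g \in 0 :: R); last first.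
  move=> wg; rewrite (@weight_indep _ x g) //.
  by move: gD; rewrite inE negb_or => /andP[/negbTE -> /negbTE ->].
rewrite (big_rem g gD) /= => wg.
suff E : \sum_(h <- rem g (0 :: R)) x h = 0.
  rewrite [X in _ + X]E addr0 /x; move: gD; rewrite inE; case: eqP => //= _ ->.
  by [].
apply: (@weight_indep _ x g) => [h /mem_rem||]; first exact: wx.
  by rewrite mem_rem_uniq // !inE eqxx.
set s := \sum_(h <- rem _ _) _.
by rewrite -(addKr (x g) s) addrC; apply: weightB => //; apply: wx.
Qed.

Lemma weight_space_root g X : g \in R -> X \in lie G -> weight g X ->
  exists c, X = c *: rvec g.
Proof.
move=> gR; rewrite lieG_wsp => /wspP [t tT [c _ ->]] /(weight_comp tT) ->.
by exists (c g); rewrite gR; case: eqP => // g0; rewrite g0 in gR.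
Qed.

Lemma weight_space0 X : X \in lie G -> weight 0 X -> X \in lie T.
Proof.
by rewrite lieG_wsp => /wspP [t tT [c _ ->]] /(weight_comp tT) ->; rewrite eqxx.
Qed.

Lemma weight_space_none g X : g \notin 0 :: R -> X \in lie G -> weight g X -> X = 0.
Proof.
rewrite inE negb_or => /andP[/negbTE g0 /negbTE gR].
by rewrite lieG_wsp => /wspP [t tT [c _ ->]] /(weight_comp tT) ->; rewrite g0 gR.
Qed.

Lemma rvec_wsp (P : pred (int * int)) g : g \in R -> (rvec g \in wsp P) = P g.
Proof.
move=> gR; apply/idP/idP => [/wspP [t tT [c cP E]]|Pg].
  have := weight_rvec gR; rewrite {1}E => /(weight_comp tT); rewrite -E gR.
  case: eqP => [g0|_ Ec]; first by rewrite g0 in gR.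
  apply: contrapT => /negP /cP c0; have := rvec_neq0 gR.
  by rewrite Ec c0 scale0r eqxx.
apply/wspP; exists 0; rewrite ?mem0v //; exists (fun h => (h == g)%:R) => [h nPh|].
  by case: eqP => // hg; rewrite hg Pg in nPh.
rewrite add0r (bigD1_seq g) //= eqxx scale1r big1 ?addr0 // => h /negbTE ->.
by rewrite scale0r.
Qed.

Lemma lieT_wsp (P : pred (int * int)) : (lie T <= wsp P)%VS.
Proof. exact: addvSl. Qed.

Lemma wsp_sub (P Q : pred (int * int)) : (forall g, g \in R -> P g -> Q g) ->
  (wsp P <= wsp Q)%VS.
Proof.
move=> PQ; apply/subvP => X /wspP [t tT [c cP ->]].
apply: rpredD; first exact: (subvP (lieT_wsp Q)).
rewrite big_seq; apply: rpred_sum => g gR; have [Pg|/cP ->] := boolP (P g).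
  by rewrite rpredZ // rvec_wsp // PQ.
by rewrite scale0r rpred0.
Qed.

Lemma wsp_cons (P : pred (int * int)) g : g \in R ->
  (wsp P + <[rvec g]>)%VS = wsp (predU1 g P).
Proof.
move=> gR; apply/eqP; rewrite eqEsubv subv_add -memvE rvec_wsp //= eqxx andbT.
rewrite wsp_sub => [/=|h _ /= ->]; last exact: orbT.
apply/subvP => X /wspP [t tT [c cP ->]]; apply: rpredD.
  by apply: (subvP (addvSl _ _)); apply: (subvP (lieT_wsp P)).
rewrite big_seq; apply: rpred_sum => h hR.
have [/= /predU1P[->|Ph]|/cP ->] := boolP (predU1 g P h); last by rewrite scale0r mem0v.
  by rewrite rpredZ // (subvP (addvSr _ _)) // memv_line.
by rewrite rpredZ // (subvP (addvSl _ _)) // rvec_wsp.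
Qed.

Lemma wsp_disjoint (P : pred (int * int)) g : g \in R -> ~~ P g ->
  (wsp P :&: <[rvec g]>)%VS = 0%VS.
Proof.
move=> gR nPg; apply/eqP; rewrite -subv0; apply/subvP => X.
rewrite memv_cap memv0 => /andP[XP /vlineP[c E]]; rewrite E in XP *.
rewrite scaler_eq0; case: eqP => //= /eqP c0; case/negP: nPg.
by rewrite -rvec_wsp // -[rvec g]scale1r -(mulVf c0) -scalerA rpredZ.
Qed.

Lemma rvec_G g : g \in R -> rvec g \in lie G.
Proof. by move=> gR; rewrite lieG_wsp rvec_wsp. Qed.

Lemma lieT_G X : X \in lie T -> X \in lie G.
Proof. by rewrite lieG_wsp; apply: (subvP (lieT_wsp _)). Qed.

Lemma lie_br X Y : X \in lie G -> Y \in lie G -> br X Y \in lie G.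
Proof.
by case: sgG => _ G1 GM _ XG YG; rewrite -br_commutator //; apply: lie_bracket.
Qed.

Lemma lieT_sqr X : X \in lie T -> X *m X \in lie T.
Proof. by case: sgT => _ T1 TM _; apply: lie_sqr. Qed.

Lemma br_root g h : g \in R -> h \in R -> g + h \in R ->
  exists c, br (rvec g) (rvec h) = c *: rvec (g + h).
Proof.
move=> gR hR ghR; apply: weight_space_root => //; first by rewrite lie_br ?rvec_G.
by apply: weight_br; exact: weight_rvec.
Qed.

Lemma br_opp g : g \in R -> br (rvec g) (rvec (- g)) \in lie T.
Proof.
move=> gR; have ngR := rootsN gR; apply: weight_space0; first by rewrite lie_br ?rvec_G.
by rewrite -(addrN g); apply: weight_br; exact: weight_rvec.
Qed.

Lemma br_none g h : g \in R -> h \in R -> g + h \notin 0 :: R ->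
  br (rvec g) (rvec h) = 0.
Proof.
move=> gR hR gh; apply: (@weight_space_none (g + h)) => //.
  by rewrite lie_br ?rvec_G.
by apply: weight_br; exact: weight_rvec.
Qed.

Lemma br_lieT_root t g : t \in lie T -> g \in R -> exists c, br t (rvec g) = c *: rvec g.
Proof.
move=> tT gR; apply: weight_space_root => //; first by rewrite lie_br ?rvec_G ?lieT_G.
by rewrite -[g in weight g]add0r; apply: weight_br;
  [exact: weight_lieT|exact: weight_rvec].
Qed.

Lemma br_lieT s t : s \in lie T -> t \in lie T -> br s t \in lie T.
Proof.
case: sgT => _ T1 TM _ sT tT; rewrite -br_commutator //; exact: lie_bracket.
Qed.

(** * The Weyl element and root strings *)

Lemma phi_lower g a : g \in R -> phi g (lower2 a) = phi (- g) (upper2 a).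
Proof. by move=> gR; exact: (G2_phi_opp real). Qed.

Lemma phi_swapK g : g \in R -> phi g (swap2 k) *m phi g (swap2 k) = 1%:M.
Proof. by move=> gR; rewrite -phiM ?swap2K ?phi1 //; exact: SL2_swap. Qed.

Definition wAd g (v : 'M[k]_n) := phi g (swap2 k) *m v *m phi g (swap2 k).

Lemma wAd_neq0 g v : g \in R -> v != 0 -> wAd g v != 0.
Proof.
move=> gR; apply: contra_neq => wv0.
have : phi g (swap2 k) *m wAd g v *m phi g (swap2 k) = 0 by rewrite wv0 mulmx0 mul0mx.
by rewrite /wAd !mulmxA phi_swapK // mul1mx -mulmxA phi_swapK // mulmx1.
Qed.

Lemma wAd_br g u v : g \in R -> wAd g (br u v) = br (wAd g u) (wAd g v).
Proof.
move=> gR; rewrite !brE /wAd mulmxDr mulmxDl; congr (_ + _);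
  by rewrite !mulmxA -[in RHS](mulmxA _ (phi g _) (phi g _)) phi_swapK // mulmx1.
Qed.

Lemma wAd_lieG g v : g \in R -> v \in lie G -> wAd g v \in lie G.
Proof.
move=> gR vG; have Gw := phi_G gR (SL2_swap ch2).
rewrite /wAd -[X in _ *m X](phi_inv gR (SL2_swap ch2) (SL2_swap ch2) (swap2K _)).
apply: lie_conj => // [|B GB]; first exact: G_unit.
by case: sgG => _ _ GM GV; apply: (GM); [exact: GM|exact: GV].
Qed.

(** Write the swap as x_g(1) x_{-g}(1) x_g(1); conjugation by [t] rescales the three parameters, and
    [swap2_torus] reassembles the product. *)
Lemma conj_swap g t : g \in R -> T t ->
  t *m phi g (swap2 k) *m invmx t = phi g (swap2 k *m diag2 (wt g t)^-1).
Proof.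
move=> gR Tt; have ut := T_unit Tt; have l0 := wt_neq0 g Tt; have ngR := rootsN gR.
rewrite -swap2_torus // [X in phi g X](swap2E ch2).
rewrite !phiM //; try by [exact: SL2_upper|exact: SL2_lower|
  apply: SL2_mul; [exact: SL2_upper|exact: SL2_lower]].
rewrite !conj_mul // !phi_lower // !(G2_phi_conj real) //.
by rewrite !mulr1 wtN // mulr1.
Qed.

(* [m] is the pairing of [h] with the coroot of [g], so that the last         *)
(* hypothesis says that [h'] is the reflection of [h] in [g].                 *)
Lemma weight_wAd g h h' v (m : int) : g \in R -> weight h v ->
  (forall c, c != 0 -> wt h (phi g (diag2 c)) = c ^ m) ->
  (forall t, T t -> wt h' t = wt h t * (wt g t)^-1 ^ m) ->
  weight h' (wAd g v).
Proof.
move=> gR wv hm h'E t Tt; have ut := T_unit Tt; have l0 := wt_neq0 g Tt.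
set c := (wt g t)^-1; have c0 : c != 0 by rewrite invr_eq0.
have Td : T (phi g (diag2 c)) by exact: (G2_coroot real).
rewrite /wAd !conj_mul // !conj_swap // -/c wv // -scalemxAr -scalemxAl.
have {2}-> : phi g (swap2 k *m diag2 c) = invmx (phi g (diag2 c)) *m phi g (swap2 k).
  have iE := phi_inv gR (SL2_diag c0).
  rewrite (iE (diag2 c^-1)) ?diag2K //; last by apply: SL2_diag; rewrite invr_eq0.
  rewrite -phiM //; try exact: SL2_swap; last by apply: SL2_diag; rewrite invr_eq0.
  congr (phi g _).
  by apply: mx2P; rewrite !mul2E !mxE /= ?invrK; ring.
rewrite phiM //; [|exact: SL2_swap|exact: SL2_diag].
rewrite h'E // -/c -hm // -scalerA; congr (_ *: _).
by rewrite scalemxAl scalemxAr -(wv _ Td) !mulmxA.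
Qed.

(** The coefficient of degree i > 0 has weight h + i g, which does not occur in Lie G. [rAd_top]
    applies this to -g. *)
Lemma rAd_lowest g h v : g \in R -> v \in lie G -> weight h v ->
  (forall i, h + g *+ i.+1 \notin 0 :: R) -> rAd g v = mxC v.
Proof.
move=> gR vG wv low; apply: mxev_inj => a; rewrite mxevC.
rewrite (@mxev_sum _ _ _ _ (mxdeg (rAd g v)).+1) // big_ord_recl expr0 scale1r.
rewrite rAd_coef0 // big1 ?addr0 // => i _.
have -> : mxcoef (lift ord0 i) (rAd g v) = 0; last by rewrite scaler0.
apply: (@weight_space_none (h + g *+ i.+1)) => //; first exact: rAd_lieG.
by rewrite lift0; exact: weight_rAd.
Qed.

(* The Bruhat factorization of [upper2 a] shows that the top coefficient of   *)
(* its action on a lowest weight vector is the action of the Weyl element.    *)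
Lemma rAd_top g h v m : g \in R -> v \in lie G -> weight h v ->
  (forall i, h - g *+ i.+1 \notin 0 :: R) ->
  (forall c, c != 0 -> wt h (phi g (diag2 c)) = c ^- m) ->
  mxcoef m (rAd g v) = wAd g v.
Proof.
move=> gR vG wv low hm; have ngR := rootsN gR.
set w := wAd g v; set P := rAd g v; set Q := rAd (- g) w.
pose N := mxdeg Q.
have lowv a : phi g (lower2 a) *m v *m phi g (lower2 a) = v.
  rewrite phi_lower // -rAdE // (@rAd_lowest _ h) ?mxevC // => i.
  by rewrite mulNrn.
(* The innermost lower factors fix [v], the torus factor scales it by a^m, and the outer lower
   factors act on [w] through [Q] at 1/a. *)
have E a : a != 0 -> mxev a P = a ^+ m *: mxev a^-1 Q.
  move=> a0; have a0' : a^-1 != 0 by rewrite invr_eq0.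
  have lowS := SL2_lower a^-1; have swS := SL2_swap ch2.
  have dS := SL2_diag a0'; have dS' := SL2_diag a0.
  have inv1 : phi g (upper2 a) = phi g (lower2 a^-1) *m phi g (swap2 k) *m
      phi g (diag2 a^-1) *m phi g (lower2 a^-1).
    by rewrite upper2_bruhat // !phiM //; do ?apply: SL2_mul.
  have inv2 : phi g (upper2 a) = phi g (lower2 a^-1) *m invmx (phi g (diag2 a^-1)) *m
      phi g (swap2 k) *m phi g (lower2 a^-1).
    rewrite (phi_inv gR dS dS'); last by rewrite -[in RHS](diag2K a0') invrK.
    rewrite -!phiM //; do ?apply: SL2_mul => //; congr (phi g _).
    rewrite upper2_bruhat //; congr (_ *m _); rewrite -!mulmxA; congr (_ *m _).
    by apply: mx2P; rewrite !mul2E !mxE /= ?invrK; ring.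
  rewrite !rAdE // -phi_lower // {1}inv1 inv2.
  have Td : T (phi g (diag2 a^-1)) by exact: (G2_coroot real).
  have wd := wv _ Td; rewrite hm // exprVn invrK in wd.
  move: (lowv a^-1) wd; rewrite /w /wAd; move: (phi g (lower2 _)) (phi g (diag2 _))
    (invmx _) (phi g (swap2 k)) => L D D' W Lv Dv.
  transitivity (L *m W *m (D *m (L *m v *m L) *m D') *m W *m L).
    by rewrite !mulmxA.
  by rewrite Lv Dv -!scalemxAr -!scalemxAl !mulmxA.
(* [S] is a^N Q(1/a). Comparing coefficients of degree N + m in X^N P = X^m S identifies coefficient
   [m] of [P] with Q(0) = [w]. *)
pose S := \sum_(j < N.+1) 'X^(N - j) *: mxC (mxcoef j Q).
have PE : 'X^N *: P = 'X^m *: S.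
  apply: mxev_inj_unit => a a0; rewrite !mxev_scale !hornerXn E // scalerA mulrC.
  rewrite -scalerA; congr (_ *: _); rewrite (@mxev_sum _ _ _ _ N.+1) // scaler_sumr.
  rewrite /S /mxev raddf_sum; apply: eq_bigr => j _.
  rewrite -[RHS]/(mxev a _) mxev_scale mxevC hornerXn scalerA; congr (_ *: _).
  rewrite exprVn; have jN : (j <= N)%N by rewrite -ltnS.
  by rewrite -{1}(subnK jN) exprD mulfK ?expf_neq0.
have XnE l (M : 'M[{poly k}]_n) d : mxcoef (d + l) ('X^l *: M) = mxcoef d M.
  by apply/matrixP => r s; rewrite !mxE coefXnM ltnNge leq_addl addnK.
rewrite -[LHS](XnE N) PE addnC XnE /S.
rewrite mxcoef_sum (bigD1 ord0) //= big1 => [|j /negbTE j0].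
  rewrite subn0 addr0 -[X in mxcoef X _]add0n XnE mxcoefC /=.
  exact: rAd_coef0.
apply/matrixP => r s; rewrite !mxE coefXnM ltnNge leq_subr /=.
have jN : (j <= N)%N by rewrite -ltnS.
by rewrite coefC subKn // (_ : (j == 0 :> nat) = false).
Qed.

(** Here m = 1, so the top coefficient of [rAd_top] is the linear one, that is, the bracket. *)
Lemma rvec_string1 g h : g \in R -> h \in R ->
  (forall i, h - g *+ i.+1 \notin 0 :: R) ->
  (forall c, c != 0 -> wt h (phi g (diag2 c)) = c^-1) ->
  br (rvec g) (rvec h) != 0.
Proof.
move=> gR hR low hm; rewrite -rAd_coef1 // (@rAd_top _ h) //.
- by rewrite wAd_neq0 ?rvec_neq0.
- exact: rvec_G.
- exact: weight_rvec.
Qed.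

Lemma natr_odd i : i%:R = (odd i)%:R :> k.
Proof.
rewrite -[in LHS](odd_double_half i) natrD -muln2 natrM (pcharf0 ch2).
by rewrite mulr0 addr0.
Qed.

(* A string of length 4 is the Steinberg module L(1) (x) L(1)^(2), on which   *)
(* the Lie algebra acts through the first factor only.                        *)
Lemma rvec_string3 g h : g \in R -> h \in R -> h + g \in R -> h + g *+ 2 \in R ->
  (forall i, h - g *+ i.+1 \notin 0 :: R) ->
  (forall c, c != 0 -> wt h (phi g (diag2 c)) = c ^- 3) ->
  [/\ br (rvec g) (rvec h) != 0, br (rvec g) (rvec (h + g)) = 0 &
      br (rvec g) (rvec (h + g *+ 2)) != 0].
Proof.
move=> gR hR hgR h2gR low hm; set e := rvec g; set v := rvec h.
have vG : v \in lie G by exact: rvec_G.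
have wv : weight h v by exact: weight_rvec.
pose F i := mxcoef i (rAd g v).
have F3 : F 3%N != 0 by rewrite /F (@rAd_top _ h) // wAd_neq0 // rvec_neq0.
have Fw i : h + g *+ i \in R -> exists c, F i = c *: rvec (h + g *+ i).
  move=> iR; apply: weight_space_root => //; first exact: rAd_lieG.
  exact: weight_rAd.
have FD i : br e (F i) = (odd i.+1)%:R *: F i.+1.
  by rewrite -rAd_deriv // -scaler_nat natr_odd.
have F0 : F 0%N = v by exact: rAd_coef0.
have eF2 : br e (F 2%N) != 0 by rewrite FD scale1r.
(* If [e, v] = 0, then [e, F 2], being the coefficient of degree 2 of Ad([e, v]), vanishes too; but
   it equals 3 F 3 = F 3. *)
have ev : br e v != 0.
  apply/eqP => ev0; have := rAd_br v 2 gR; rewrite ev0 -/e -/(F 2%N) => E.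
  have r0 : rAd g 0 = 0 by rewrite /rAd /mxC map_mx0 mulmx0 mul0mx.
  move: eF2; rewrite -E r0 => /eqP; case.
  by apply/matrixP => r s; rewrite !mxE coef0.
split=> //.
- have [|c cE] := Fw 1%N; first by rewrite mulr1n.
  have eF1 := FD 1%N; rewrite scale0r in eF1.
  have F1 : F 1%N != 0 by rewrite -F0 FD scale1r in ev.
  rewrite cE mulr1n in eF1 F1.
  have c0 : c != 0 by apply: contraNneq F1 => ->; rewrite scale0r.
  by move/eqP: eF1; rewrite brZr scaler_eq0 (negbTE c0) => /eqP.
have [|c cE] := Fw 2%N; first by [].
by apply: contraNneq eF2 => br0; rewrite cE brZr br0 scaler0.
Qed.

(** A weight h - (i+1) g differs from [h] by a vector parallel to [g] (zero cross product) and in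
    its direction (positive dot product). This replaces the quantifier over [i] by a finite test. *)
Lemma string_low g h : 0 < g.1 * g.1 + g.2 * g.2 ->
  all (fun d => ((h.1 - d.1) * g.2 != (h.2 - d.2) * g.1)
     || ((h.1 - d.1) * g.1 + (h.2 - d.2) * g.2 <= 0)) (0 :: R) ->
  forall i, h - g *+ i.+1 \notin 0 :: R.
Proof.
move=> g0 /allP H i; apply/negP => /H.
have E j : ((g *+ j).1 = g.1 * j%:Z) /\ ((g *+ j).2 = g.2 * j%:Z).
  elim: j => [|j [IH1 IH2]]; first by rewrite !mulr0.
  by rewrite mulrS /= IH1 IH2 intS; split; ring.
have [E1 E2] := E i.+1; rewrite /= E1 E2.
have -> : h.1 - (h.1 - g.1 * i.+1%:Z) = g.1 * i.+1%:Z by ring.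
have -> : h.2 - (h.2 - g.2 * i.+1%:Z) = g.2 * i.+1%:Z by ring.
case/orP => [/eqP []|]; first by ring.
have -> : g.1 * i.+1%:Z * g.1 + g.2 * i.+1%:Z * g.2 =
  (g.1 * g.1 + g.2 * g.2) * i.+1%:Z by ring.
by rewrite Num.Theory.pmulr_lle0 // leNgt g0.
Qed.

(** [G2_phi_opp] relates [phi g] and [phi (- g)] only on unipotent elements, so both diagonal
    matrices are written as words in these. *)
Lemma phi_diagN g c : g \in R -> c != 0 -> phi (- g) (diag2 c) = phi g (diag2 c^-1).
Proof.
move=> gR c0; have ngR := rootsN gR; have c0' : c^-1 != 0 by rewrite invr_eq0.
have e1 : diag2 c = swap2 k *m (upper2 c^-1 *m lower2 c *m upper2 c^-1).
  rewrite -[c in lower2 c]invrK swap2_torus // invrK !mulmxA swap2K //.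
  by rewrite mul1mx.
have e2 : diag2 c^-1 = swap2 k *m (lower2 c^-1 *m upper2 c *m lower2 c^-1).
  have cc x : x + x = 0 :> k by rewrite addrr_pchar2.
  by apply: mx2P; rewrite !entry2E ?invrK ?divff ?mulVf ?invr_eq0 // ?cc ?entry2E ?cc.
have low a : phi (- g) (lower2 a) = phi g (upper2 a).
  by rewrite (G2_phi_opp real) // opprK.
have lowg a : phi g (lower2 a) = phi (- g) (upper2 a) by exact: phi_lower.
have U := @SL2_upper k; have L := @SL2_lower k; have M := @SL2_mul k.
have sw : swap2 k = lower2 1 *m upper2 1 *m lower2 1.
  by apply: mx2P; rewrite !entry2E /= ?addrr_pchar2 ?entry2E.
rewrite e1 [in LHS](swap2E ch2) e2 [in RHS]sw.
by rewrite !phiM ?low ?lowg //; do ?[exact: U | exact: L | apply: (M)].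
Qed.

(** * Structure constants of the Lie algebra *)

Local Notation e a b := (rvec (a, b)).

Ltac low := by apply: string_low.
Ltac pairing1 := by move=> c c0; rewrite wt_coroot1.
Ltac pairing2 := by move=> c c0; rewrite wt_coroot2.
Ltac pairingN1 := by move=> c c0;
  rewrite -exprVn (@phi_diagN (1, 0)) // wt_coroot1 ?invr_eq0.
Ltac pairingN2 := by move=> c c0; rewrite (@phi_diagN (0, 1)) // wt_coroot2 ?invr_eq0.

Lemma br_01_N11 : br (e 0 1) (e (-1) (-1)) != 0.
Proof. apply: rvec_string1 => //; [low|pairing2]. Qed.

Lemma br_01_N32 : br (e 0 1) (e (-3) (-2)) != 0.
Proof. apply: rvec_string1 => //; [low|pairing2]. Qed.

Lemma br_01_10 : br (e 0 1) (e 1 0) != 0.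
Proof. apply: rvec_string1 => //; [low|pairing2]. Qed.

Lemma br_N01_N10 : br (e 0 (-1)) (e (-1) 0) != 0.
Proof. apply: rvec_string1 => //; [low|pairingN2]. Qed.

Lemma br_N01_N31 : br (e 0 (-1)) (e (-3) (-1)) != 0.
Proof. apply: rvec_string1 => //; [low|pairingN2]. Qed.

Lemma br_N01_11 : br (e 0 (-1)) (e 1 1) != 0.
Proof. apply: rvec_string1 => //; [low|pairingN2]. Qed.

Lemma string_10 : [/\ br (e 1 0) (e (-3) (-1)) != 0,
  br (e 1 0) (e (-2) (-1)) = 0 & br (e 1 0) (e (-1) (-1)) != 0].
Proof. apply: (@rvec_string3 (1, 0) (-3, -1)) => //; [low|pairing1]. Qed.

Lemma string_N10 : [/\ br (e (-1) 0) (e 0 (-1)) != 0,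
  br (e (-1) 0) (e (-1) (-1)) = 0 & br (e (-1) 0) (e (-2) (-1)) != 0].
Proof. apply: (@rvec_string3 (-1, 0) (0, -1)) => //; [low|pairingN1]. Qed.

(** e_{alpha1+alpha2} is a multiple of [e_alpha2, e_alpha1]; both of these kill e_{-2
    alpha1-alpha2}, and Jacobi concludes. *)
Lemma br_11_N21 : br (e 1 1) (e (-2) (-1)) = 0.
Proof.
have [c E] : exists c, br (e 0 1) (e 1 0) = c *: e 1 1 by exact: (@br_root (0, 1) (1, 0)).
have c0 : c != 0 by apply: contraNneq br_01_10 => c0; rewrite E c0 scale0r.
apply: (scalerI c0); rewrite -brZl -E scaler0.
have [_ z _] := string_10.
have J := brJ ch2 (e 0 1) (e 1 0) (e (-2) (-1)).
rewrite z br0r (@br_none (0, 1) (-2, -1)) // br0r addr0 in J.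
by rewrite -J.
Qed.

(** The reflection in alpha1 sends the two roots to alpha1+alpha2 and -alpha2, whose bracket is
    nonzero by [br_N01_11]. *)
Lemma br_21_N31 : br (e 2 1) (e (-3) (-1)) != 0.
Proof.
have R10 : (1, 0) \in R by []; have l0 := wt_neq0 (1, 0).
have [|||c1 E1] := @weight_space_root (1, 1) (wAd (1, 0) (e 2 1)) => //.
- by apply: wAd_lieG => //; exact: rvec_G.
- apply: (@weight_wAd _ (2, 1) _ _ 1) => //; first exact: weight_rvec.
    by pairing1.
  by move=> t Tt; rewrite expr1z -wtN // -wtD.
have [|||c2 E2] := @weight_space_root (0, -1) (wAd (1, 0) (e (-3) (-1))) => //.
- by apply: wAd_lieG => //; exact: rvec_G.
- apply: (@weight_wAd _ (-3, -1) _ _ (-3)) => //; first exact: weight_rvec.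
    by pairing1.
  by move=> t Tt; rewrite -exprnN -exprVn invrK -wtMn // -wtD.
have n1 := wAd_neq0 R10 (rvec_neq0 (isT : (2, 1) \in R)).
have n2 := wAd_neq0 R10 (rvec_neq0 (isT : (-3, -1) \in R)).
apply: contraTneq isT => z; have := wAd_br (e 2 1) (e (-3) (-1)) R10.
rewrite z E1 E2 brZl brZr [wAd _ 0]/wAd mulmx0 mul0mx => /esym/eqP.
rewrite scaler_eq0 scaler_eq0 brC (negbTE br_N01_11) orbF => /orP[] /eqP c0.
  by rewrite E1 c0 scale0r eqxx in n1.
by rewrite E2 c0 scale0r eqxx in n2.
Qed.

(** * Brackets and squares of spans of root vectors *)

Lemma br_root_wsp (P : pred (int * int)) g h : g \in R -> h \in R ->
  (g + h \in R -> P (g + h)) -> br (rvec g) (rvec h) \in wsp P.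
Proof.
move=> gR hR gh; have [ghR|nghR] := boolP (g + h \in R).
  by have [c ->] := br_root gR hR ghR; rewrite rpredZ // rvec_wsp // gh.
have [/eqP gh0|/negbTE gh0] := boolP (g + h == 0).
  have -> : h = - g by apply/eqP; rewrite -addr_eq0 addrC gh0.
  by apply: (subvP (lieT_wsp P)); exact: br_opp.
by rewrite br_none ?mem0v // inE gh0.
Qed.

Lemma wsp_br (P Q S : pred (int * int)) X Y :
  (forall g, g \in R -> P g || Q g -> S g) ->
  (forall g h, g \in R -> h \in R -> P g -> Q h -> br (rvec g) (rvec h) \in wsp S) ->
  X \in wsp P -> Y \in wsp Q -> br X Y \in wsp S.
Proof.
move=> PQS PQ /wspP [t tT [c cP ->]] /wspP [u uT [d dQ ->]].
have TS := subvP (lieT_wsp S).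
have brs (Z : 'M[k]_n) (w : int * int -> 'M[k]_n) :
  br Z (\sum_(g <- R) w g) = \sum_(g <- R) br Z (w g).
  elim: (R) => [|g D IH]; first by rewrite !big_nil br0r.
  by rewrite !big_cons brDr IH.
have TR v b (B : pred (int * int)) : v \in lie T -> (forall g, ~~ B g -> b g = 0) ->
    (forall g, g \in R -> B g -> S g) -> br v (\sum_(g <- R) b g *: rvec g) \in wsp S.
  move=> vT bB BS; rewrite brs big_seq; apply: rpred_sum => g gR.
  have [Bg|/bB ->] := boolP (B g); last by rewrite scale0r br0r mem0v.
  have [a E] := br_lieT_root vT gR.
  by rewrite brZr E !rpredZ // rvec_wsp // BS.
rewrite brDl !brDr; apply: rpredD; apply: rpredD.
- by apply/TS/br_lieT.
- by apply: (TR _ _ Q) => // g gR Qg; apply: PQS; rewrite ?Qg ?orbT.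
- by rewrite brC; apply: (TR _ _ P) => // g gR Pg; apply: PQS; rewrite ?Pg.
rewrite brs big_seq; apply: rpred_sum => h hR; rewrite brC brs big_seq.
apply: rpred_sum => g gR; rewrite brZl brZr brC.
have [Pg|/cP ->] := boolP (P g); last by rewrite scale0r scaler0 mem0v.
have [Qh|/dQ ->] := boolP (Q h); last by rewrite scale0r mem0v.
by rewrite !rpredZ // PQ.
Qed.

(** (Y + Z)^2 = Y^2 + Z^2 + [Y, Z], so closure under brackets reduces the claim to Lie T and to root
    vectors, which square to 0. *)
Lemma wsp_sqr (P : pred (int * int)) X :
  (forall Y Z, Y \in wsp P -> Z \in wsp P -> br Y Z \in wsp P) ->
  X \in wsp P -> X *m X \in wsp P.
Proof.
move=> brP /wspP [t tT [c cP ->]].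
have sqD Y Z : Y \in wsp P -> Z \in wsp P -> Y *m Y \in wsp P ->
    Z *m Z \in wsp P -> (Y + Z) *m (Y + Z) \in wsp P.
  move=> YP ZP Y2 Z2.
  have -> : (Y + Z) *m (Y + Z) = Y *m Y + Z *m Z + br Y Z.
    rewrite mulmxDl !mulmxDr !brE -!addrA; congr (_ + _).
    by rewrite [RHS]addrC -addrA.
  by apply: rpredD; [exact: rpredD|exact: brP].
have rP g : g \in R -> c g *: rvec g \in wsp P.
  move=> gR; have [Pg|/cP ->] := boolP (P g); last by rewrite scale0r mem0v.
  by rewrite rpredZ // rvec_wsp.
have sP (D : seq (int * int)) : {subset D <= R} ->
    \sum_(g <- D) c g *: rvec g \in wsp P /\
    (\sum_(g <- D) c g *: rvec g) *m (\sum_(g <- D) c g *: rvec g) \in wsp P.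
  elim: D => [|g D IH] DR; first by rewrite !big_nil mul0mx mem0v.
  have [|IH1 IH2] := IH _; first by move=> h hD; apply: DR; rewrite inE hD orbT.
  have gR : g \in R by apply: DR; rewrite mem_head.
  rewrite !big_cons; split; first by rewrite rpredD // rP.
  apply: sqD => //; first exact: rP.
  by rewrite -scalemxAl -scalemxAr rvec_sqr // !scaler0 mem0v.
have tP := subvP (lieT_wsp P); have [|S1 S2] := sP R; first by [].
by apply: sqD => //; apply: tP => //; exact: lieT_sqr.
Qed.

Definition degree_ge (d : int) : pred (int * int) := fun g => d <= g.1.
Definition deg0_N21 : pred (int * int) := fun g => (0 <= g.1) || (g == (-2, -1)).

Lemma mem_scaled (U : {vspace 'M[k]_n}) c v : c != 0 -> c *: v \in U -> v \in U.
Proof. by move=> c0 H; rewrite -[v]scale1r -(mulVf c0) -scalerA rpredZ. Qed.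

Lemma br_mem (U : {vspace 'M[k]_n}) g h : g \in R -> h \in R -> g + h \in R ->
  br (rvec g) (rvec h) != 0 -> br (rvec g) (rvec h) \in U -> rvec (g + h) \in U.
Proof.
move=> gR hR ghR; have [c ->] := br_root gR hR ghR; rewrite scaler_eq0 negb_or.
by move=> /andP[c0 _]; exact: mem_scaled.
Qed.

Lemma addr_memP (U : {vspace 'M[k]_n}) u v : u \in U -> u + v \in U -> v \in U.
Proof. by move=> uU uv; rewrite -[v](addKr u) rpredD // rpredN. Qed.

(* y stands for the component in the parabolic subalgebra; the other five are *)
(* along the roots of negative degree in alpha1.                              *)
Definition comb y (x1 x2 x3 x4 x5 : k) : 'M[k]_n :=
  y + (x1 *: e (-1) 0 + x2 *: e (-1) (-1) + x3 *: e (-2) (-1)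
    + x4 *: e (-3) (-1) + x5 *: e (-3) (-2)).

Lemma combP X : X \in lie G -> exists y x1 x2 x3 x4 x5,
  y \in wsp (degree_ge 0) /\ X = comb y x1 x2 x3 x4 x5.
Proof.
rewrite lieG_wsp => /wspP [t tT [c _ ->]].
exists (t + \sum_(g <- R) (if degree_ge 0 g then c g else 0) *: rvec g).
exists (c (-1, 0)), (c (-1, -1)), (c (-2, -1)), (c (-3, -1)), (c (-3, -2)); split.
  apply/wspP; exists t => //; eexists; last by [].
  by move=> g /negbTE /= ->.
rewrite /comb -addrA; congr (_ + _).
rewrite /G2_roots /= !big_cons !big_nil /degree_ge /= !scale0r !add0r !addr0.
rewrite -!addrA; do 6 congr (_ + _).
by rewrite addrCA.
Qed.

(** * Overalgebras of the parabolic subalgebra *)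

Local Notation q := (wsp (degree_ge 0)).

Lemma wsp_subP (P : pred (int * int)) (U : {vspace 'M[k]_n}) : (lie T <= U)%VS ->
  (forall g, g \in R -> P g -> rvec g \in U) -> (wsp P <= U)%VS.
Proof.
move=> TU PU; apply/subvP => X /wspP [t tT [c cP ->]].
apply: rpredD; first exact: (subvP TU).
rewrite big_seq; apply: rpred_sum => g gR.
have [Pg|/cP ->] := boolP (P g); last by rewrite scale0r mem0v.
by rewrite rpredZ // PU.
Qed.

Lemma br_wsp_q X Y : X \in q -> Y \in q -> br X Y \in q.
Proof.
apply: wsp_br => [g _ /orP[]|g h gR hR g0 h0] //.
by apply: br_root_wsp => // _; rewrite /degree_ge /= in g0 h0 *; lia.
Qed.

Ltac mem_sum := repeat first [ done | by rewrite rvec_wsp | by apply: br_root_wsp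
  | by apply: br_wsp_q; rewrite ?rvec_wsp | apply: rpredZ | apply: rpredD ].

Lemma br_comb v y x1 x2 x3 x4 x5 : br v (comb y x1 x2 x3 x4 x5) =
  br v y + (x1 *: br v (e (-1) 0) + x2 *: br v (e (-1) (-1))
    + x3 *: br v (e (-2) (-1)) + x4 *: br v (e (-3) (-1)) + x5 *: br v (e (-3) (-2))).
Proof. by rewrite /comb !brDr !brZr. Qed.

(** ad e_alpha1 sends degree -1 into [q] and kills degree -2 and the root -3 alpha1-2 alpha2; only
    the [x4] term can leave [q]. *)
Lemma br_10_comb y x1 x2 x3 x4 x5 : y \in q ->
  exists2 y', y' \in q & br (e 1 0) (comb y x1 x2 x3 x4 x5) =
    y' + x4 *: br (e 1 0) (e (-3) (-1)).
Proof.
move=> yq; have [_ z _] := string_10; rewrite br_comb z (@br_none _ (-3, -2)) //.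
rewrite !scaler0 !addr0 addrA; eexists; last by [].
have q10 : e 1 0 \in q by rewrite rvec_wsp.
by mem_sum.
Qed.

Lemma br_01_comb y x1 x2 x3 x4 x5 :
  br (e 0 1) (comb y x1 x2 x3 x4 x5) =
    br (e 0 1) y + (x2 *: br (e 0 1) (e (-1) (-1)) + x5 *: br (e 0 1) (e (-3) (-2))).
Proof.
rewrite br_comb (@br_none _ (-1, 0)) // (@br_none _ (-2, -1)) //.
by rewrite (@br_none _ (-3, -1)) // !scaler0 !addr0 add0r.
Qed.

Lemma br_N01_comb y x1 x2 x3 x4 x5 :
  br (e 0 (-1)) (comb y x1 x2 x3 x4 x5) =
    br (e 0 (-1)) y + (x1 *: br (e 0 (-1)) (e (-1) 0)
      + x4 *: br (e 0 (-1)) (e (-3) (-1))).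
Proof.
rewrite br_comb (@br_none _ (-1, -1)) // (@br_none _ (-2, -1)) //.
by rewrite (@br_none _ (-3, -2)) // !scaler0 !addr0.
Qed.

Lemma neg_rootP g : g \in R -> ~~ degree_ge 0 g ->
  g \in [:: (-1, 0); (-1, -1); (-2, -1); (-3, -1); (-3, -2)].
Proof.
have /allP H : all (fun g => ~~ degree_ge 0 g ==>
  (g \in [:: (-1, 0); (-1, -1); (-2, -1); (-3, -1); (-3, -2)])) R by [].
by move=> /H /implyP.
Qed.

Section Overspace.
Variables (U : {vspace 'M[k]_n}) (y : 'M[k]_n) (x1 x2 x3 x4 x5 : k).
Let X := comb y x1 x2 x3 x4 x5.
Hypotheses (qU : (q <= U)%VS) (yq : y \in q).
Hypothesis UX : forall v, v \in q -> br v X \in U.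
Hypothesis UU : forall v Z, v \in q -> Z \in U -> br v Z \in U.

Let qroot g : g \in R -> degree_ge 0 g -> rvec g \in q.
Proof. by move=> gR g0; rewrite rvec_wsp. Qed.

(** The lemmas of this section serve twice: with U = [q] for the normalizer of [q], and with [U] an
    overalgebra containing X. *)
Lemma over_x4 : x4 != 0 -> e (-2) (-1) \in U.
Proof.
move=> n4; have := UX (qroot (isT : (1, 0) \in R) isT); rewrite /X.
have [y' /(subvP qU) y'U ->] := br_10_comb x1 x2 x3 x4 x5 yq.
move=> /(addr_memP y'U) /(mem_scaled n4).
by apply: (@br_mem _ (1, 0) (-3, -1)) => //; case: string_10.
Qed.

(** ad e_alpha2 followed by ad e_alpha1 leads from -3 alpha1-2 alpha2 to -2 alpha1-alpha2, while the
    [x2] term ends in Lie T. *)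
Lemma over_x5 : x5 != 0 -> e (-2) (-1) \in U.
Proof.
move=> n5; have q10 : e 1 0 \in q by exact: qroot.
have q01 : e 0 1 \in q by exact: qroot.
have := UU q10 (UX q01); rewrite /X br_01_comb !brDr !brZr.
have yU : br (e 1 0) (br (e 0 1) y) \in U by apply: (subvP qU); rewrite !br_wsp_q.
have [a Ea] : exists a, br (e 0 1) (e (-1) (-1)) = a *: e (-1) 0.
  exact: (@br_root (0, 1) (-1, -1)).
have [b Eb] : exists b, br (e 0 1) (e (-3) (-2)) = b *: e (-3) (-1).
  exact: (@br_root (0, 1) (-3, -2)).
have b0 : b != 0 by apply: contraNneq br_01_N32 => b0; rewrite Eb b0 scale0r.
have hU : x2 *: br (e 1 0) (a *: e (-1) 0) \in U.
  by rewrite brZr !rpredZ // (subvP qU) //; mem_sum.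
rewrite Ea Eb => /(addr_memP yU) /(addr_memP hU) /(mem_scaled n5).
rewrite brZr => /(mem_scaled b0).
by apply: (@br_mem _ (1, 0) (-3, -1)) => //; case: string_10.
Qed.

Lemma over_x2 : x5 = 0 -> x2 != 0 -> e (-1) 0 \in U.
Proof.
move=> z5 n2; have q01 : e 0 1 \in q by exact: qroot.
have := UX q01; rewrite /X br_01_comb z5 scale0r addr0.
have yU : br (e 0 1) y \in U by apply: (subvP qU); rewrite br_wsp_q.
move=> /(addr_memP yU) /(mem_scaled n2).
by apply: (@br_mem _ (0, 1) (-1, -1)) => //; exact: br_01_N11.
Qed.

Lemma over_x1 : x4 = 0 -> x1 != 0 -> e (-1) (-1) \in U.
Proof.
move=> z4 n1; have q01 : e 0 (-1) \in q by exact: qroot.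
have := UX q01; rewrite /X br_N01_comb z4 scale0r addr0.
have yU : br (e 0 (-1)) y \in U by apply: (subvP qU); rewrite br_wsp_q.
move=> /(addr_memP yU) /(mem_scaled n1).
by apply: (@br_mem _ (0, -1) (-1, 0)) => //; exact: br_N01_N10.
Qed.

End Overspace.

(* The parabolic subalgebra is its own normalizer; the component at           *)
(* -2 alpha1 - alpha2 is detected by the torus element [e_alpha1, e_-alpha1]. *)
Lemma wsp_q_normalizer X : X \in lie G -> (forall v, v \in q -> br v X \in q) -> X \in q.
Proof.
move=> /combP [y [x1 [x2 [x3 [x4 [x5 [yq ->]]]]]]] Xq.
have out g : g \in R -> ~~ degree_ge 0 g -> rvec g \notin q.
  by move=> gR; rewrite rvec_wsp.
have z4 : x4 = 0.
  by apply/eqP; apply: contraT => /(over_x4 (subvv _) yq Xq); rewrite rvec_wsp.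
have z5 : x5 = 0.
  apply/eqP; apply: contraT => /(over_x5 (subvv _) yq Xq) H.
  by move: (H br_wsp_q); rewrite rvec_wsp.
have z2 : x2 = 0.
  by apply/eqP; apply: contraT => /(over_x2 (subvv _) yq Xq z5); rewrite rvec_wsp.
have z1 : x1 = 0.
  by apply/eqP; apply: contraT => /(over_x1 (subvv _) yq Xq z4); rewrite rvec_wsp.
have [/eqP z3|n3] := boolP (x3 == 0).
  by rewrite /comb z1 z2 z3 z4 z5 !scale0r !addr0.
have Hq : br (e 1 0) (e (-1) 0) \in q.
  by apply: (subvP (lieT_wsp _)); exact: (@br_opp (1, 0)).
have := Xq _ Hq; rewrite /comb z1 z2 z4 z5 !scale0r !addr0 add0r brDr brZr.
move=> /(addr_memP (br_wsp_q Hq yq)) /(mem_scaled n3).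
(* As e_alpha1 kills e_{-2 alpha1-alpha2}, Jacobi equates the action of [e_alpha1, e_{-alpha1}] on
   it with the nonzero path down to degree -3 and back. *)
have J := brJ ch2 (e 1 0) (e (-1) 0) (e (-2) (-1)).
have [n10 z10 _] := string_10; rewrite z10 br0r addr0 in J; rewrite -J.
have [_ _ nN] := string_N10.
have [c Ec] : exists c, br (e (-1) 0) (e (-2) (-1)) = c *: e (-3) (-1).
  exact: (@br_root (-1, 0) (-2, -1)).
have c0 : c != 0 by apply: contraNneq nN => c0; rewrite Ec c0 scale0r.
rewrite Ec brZr => /(mem_scaled c0) /(@br_mem _ (1, 0) (-3, -1)) H.
by have := H isT isT isT n10; rewrite rvec_wsp.
Qed.

Section Subalgebras.
Variable s : {vspace 'M[k]_n}.
Hypotheses (qs : (q <= s)%VS) (sbr : forall X Y, X \in s -> Y \in s -> br X Y \in s).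

Let sroot g : g \in R -> degree_ge 0 g -> rvec g \in s.
Proof. by move=> gR g0; apply: (subvP qs); rewrite rvec_wsp. Qed.

Let sbr_root g h : g \in R -> h \in R -> g + h \in R ->
  br (rvec g) (rvec h) != 0 -> rvec g \in s -> rvec h \in s -> rvec (g + h) \in s.
Proof. by move=> gR hR ghR n0 gs hs; apply: br_mem => //; exact: sbr. Qed.

Lemma subalg_N10 : e (-1) 0 \in s <-> e (-1) (-1) \in s.
Proof.
split=> H.
  by apply: (@sbr_root (0, -1) (-1, 0)) => //; [exact: br_N01_N10|exact: sroot].
by apply: (@sbr_root (0, 1) (-1, -1)) => //; [exact: br_01_N11|exact: sroot].
Qed.

(** Bracketing with e_alpha1 gives degree -2, and with e_{2 alpha1+alpha2} gives e_{-alpha1}. Once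
    degrees -1 and -2 are in [s], subtracting them isolates degree -3. The coefficient [x5] is 0
    here because its bracket with e_{2 alpha1+alpha2} could have degree -1. *)
Lemma subalg_full4 y x1 x2 x3 x4 : y \in q -> x4 != 0 ->
  comb y x1 x2 x3 x4 0 \in s -> (lie G <= s)%VS.
Proof.
move=> yq n4 Xs; have qX v : v \in q -> br v (comb y x1 x2 x3 x4 0) \in s.
  by move=> /(subvP qs) vs; exact: sbr.
have s21 := over_x4 qs yq qX n4.
have s10 : e (-1) 0 \in s.
  have : br (e 2 1) (comb y x1 x2 x3 x4 0) \in s by apply: sbr => //; exact: sroot.
  rewrite br_comb scale0r addr0 addrA => H0; have H u0 := addr_memP u0 H0.
  suff /H /(mem_scaled n4) : br (e 2 1) y + (x1 *: br (e 2 1) (e (-1) 0) +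
     x2 *: br (e 2 1) (e (-1) (-1)) + x3 *: br (e 2 1) (e (-2) (-1))) \in s.
    by apply: (@br_mem _ (2, 1) (-3, -1)) => //; exact: br_21_N31.
  apply: (subvP qs); have q21 : e 2 1 \in q by rewrite rvec_wsp.
  by mem_sum.
have s11 : e (-1) (-1) \in s by apply/subalg_N10.
have s31 : e (-3) (-1) \in s.
  move: Xs; rewrite /comb scale0r addr0 => /(addr_memP (subvP qs _ yq)).
  by move=> H0; have H u0 := addr_memP u0 H0; apply: (mem_scaled n4); apply: H; mem_sum.
have s32 : e (-3) (-2) \in s.
  by apply: (@sbr_root (0, -1) (-3, -1)) => //; [exact: br_N01_N31|exact: sroot].
rewrite lieG_wsp; apply: wsp_subP => [|g gR _].
  exact: subv_trans (lieT_wsp _) qs.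
have [/(sroot gR) //|/(neg_rootP gR)] := boolP (degree_ge 0 g).
by rewrite !inE; do 4 ?[case/predU1P => [-> //|]]; move=> /eqP ->.
Qed.

(** If x5 != 0, ad e_alpha2 moves that component to -3 alpha1-alpha2 and kills the old [x4]
    component, which reduces to [subalg_full4]. *)
Lemma subalg_full y x1 x2 x3 x4 x5 : y \in q -> (x4 != 0) || (x5 != 0) ->
  comb y x1 x2 x3 x4 x5 \in s -> (lie G <= s)%VS.
Proof.
move=> yq; have [/eqP z5|n5] := boolP (x5 == 0).
  by rewrite orbF z5; exact: subalg_full4.
move=> _ Xs; have q01 : e 0 1 \in q by rewrite rvec_wsp.
have : br (e 0 1) (comb y x1 x2 x3 x4 x5) \in s by apply: sbr => //; exact: sroot.
have [a Ea] : exists a, br (e 0 1) (e (-1) (-1)) = a *: e (-1) 0.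
  exact: (@br_root (0, 1) (-1, -1)).
have [b Eb] : exists b, br (e 0 1) (e (-3) (-2)) = b *: e (-3) (-1).
  exact: (@br_root (0, 1) (-3, -2)).
have b0 : b != 0 by apply: contraNneq br_01_N32 => b0; rewrite Eb b0 scale0r.
have -> : br (e 0 1) (comb y x1 x2 x3 x4 x5) =
    comb (br (e 0 1) y) (x2 * a) 0 0 (x5 * b) 0.
  by rewrite br_01_comb /comb Ea Eb !scalerA !scale0r !addr0.
by apply: subalg_full4; [exact: br_wsp_q|rewrite mulf_neq0].
Qed.

(** Elements of [s] have no component of degree -3. If e_{-alpha1} is in [s], a component of degree
    -2 would produce e_{-3 alpha1-alpha2}; otherwise no component of degree -1 can occur, and only
    degree -2 is left. *)
Lemma subalg_classify : (s <= lie G)%VS -> s <> q -> s <> lie G ->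
  s = wsp deg0_N21 \/ s = wsp (degree_ge (-1)).
Proof.
move=> sG sNq sNG.
have sE X : X \in s -> exists y x1 x2 x3, y \in q /\ X = comb y x1 x2 x3 0 0.
  move=> Xs; have [y [x1 [x2 [x3 [x4 [x5 [yq E]]]]]]] := combP (subvP sG _ Xs).
  exists y, x1, x2, x3; split=> //; rewrite E in Xs *.
  have [|] := boolP ((x4 != 0) || (x5 != 0)).
    move=> /(subalg_full yq) /(_ Xs) Gs; case: sNG.
    by apply/eqP; rewrite eqEsubv sG Gs.
  by rewrite negb_or !negbK => /andP[/eqP -> /eqP ->].
have Ts : (lie T <= s)%VS by exact: subv_trans (lieT_wsp _) qs.
have Tq := lieT_wsp (degree_ge 0).
have sX y x1 x2 x3 v : comb y x1 x2 x3 0 0 \in s -> v \in q ->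
    br v (comb y x1 x2 x3 0 0) \in s.
  by move=> Xs /(subvP qs) vs; exact: sbr.
have n31 : e (-3) (-1) \notin s.
  apply/negP => H; apply: sNG; apply/eqP; rewrite eqEsubv sG /=.
  apply: (@subalg_full 0 0 0 0 1 0); rewrite ?mem0v ?oner_eq0 //.
  by rewrite /comb !scale0r !add0r addr0 scale1r.
have [s10|n10] := boolP (e (-1) 0 \in s).
  have s11 : e (-1) (-1) \in s by apply/subalg_N10.
  right; apply/eqP; rewrite eqEsubv; apply/andP; split.
    apply/subvP => X Xs; have [y [x1 [x2 [x3 [yq E]]]]] := sE X Xs.
    rewrite E /comb !scale0r !addr0; have [/eqP ->|n3] := boolP (x3 == 0).
      rewrite scale0r addr0 rpredD //; last by mem_sum.
      apply: subvP yq; apply: wsp_sub => g _; rewrite /degree_ge /=; lia.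
    case/negP: n31; apply: (@sbr_root (-1, 0) (-2, -1)) => //.
      by case: string_N10.
    move: Xs; rewrite E /comb !scale0r !addr0 => /(addr_memP (subvP qs _ yq)).
    by move=> H0; have H u0 := addr_memP u0 H0; apply: (mem_scaled n3); apply: H; mem_sum.
  apply: wsp_subP => // g gR.
  have [/(sroot gR) //|/(neg_rootP gR)] := boolP (degree_ge 0 g).
  by rewrite !inE; do 4 ?[case/predU1P => [-> //|]]; move=> /eqP ->.
have sE' X : X \in s -> exists2 y, y \in q & exists x3, X = y + x3 *: e (-2) (-1).
  move=> Xs; have [y [x1 [x2 [x3 [yq E]]]]] := sE X Xs; exists y => //; exists x3.
  rewrite E in Xs; have XX := sX _ _ _ _ _ Xs.
  have z2 : x2 = 0.
    by apply/eqP; apply: contraT => /(over_x2 qs yq XX erefl) H; rewrite H in n10.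
  have z1 : x1 = 0.
    apply/eqP; apply: contraT => /(over_x1 qs yq XX erefl) /subalg_N10 H.
    by rewrite H in n10.
  by rewrite E /comb z1 z2 !scale0r !addr0 !add0r.
left; have s21 : e (-2) (-1) \in s.
  apply: contraT => n21; case: sNq; apply/eqP; rewrite eqEsubv qs andbT.
  apply/subvP => X Xs; have [y yq [x3 E]] := sE' X Xs; rewrite E in Xs *.
  have [/eqP ->|n3] := boolP (x3 == 0); first by rewrite scale0r addr0.
  by case/negP: n21; apply: (mem_scaled n3); apply: addr_memP Xs; exact: (subvP qs).
apply/eqP; rewrite eqEsubv; apply/andP; split.
  apply/subvP => X /sE' [y yq [x3 ->]]; rewrite rpredD ?rpredZ ?rvec_wsp //.
  by apply: subvP yq; apply: wsp_sub => g _ g0; apply/orP; left.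
by apply: wsp_subP => // g gR /orP[|/eqP -> //]; exact: sroot.
Qed.

End Subalgebras.

(** * The Lie algebra of the parabolic subgroup *)

Lemma rAd_q g a Y : g \in R -> degree_ge 0 g -> Y \in q -> mxev a (rAd g Y) \in q.
Proof.
move=> gR g0; have qG : (q <= lie G)%VS by rewrite lieG_wsp; apply: wsp_sub.
have wq h v : degree_ge 0 h -> v \in lie G -> weight h v -> mxev a (rAd g v) \in q.
  move=> h0 vG wv; rewrite (@mxev_sum _ _ _ _ (mxdeg (rAd g v))) //.
  apply: rpred_sum => i _; apply: rpredZ.
  have cG : mxcoef i (rAd g v) \in lie G by exact: rAd_lieG.
  have := weight_rAd i gR wv; set d := h + g *+ i.
  (* Adding multiples of a root of nonnegative degree cannot lower the degree. *)
  have d0 : degree_ge 0 d.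
    rewrite /d /degree_ge /= (_ : (g *+ i).1 = g.1 *+ i).
      by rewrite Num.Theory.addr_ge0 // Num.Theory.mulrn_wge0.
    by elim: (nat_of_ord i) => // j IH; rewrite !mulrS /= IH.
  have [dD|dD] := boolP (d \in 0 :: R); last first.
    by move=> /(weight_space_none dD cG) ->; rewrite mem0v.
  move: dD; rewrite inE => /predU1P[->|dR].
    by move=> /(weight_space0 cG); apply: (subvP (lieT_wsp _)).
  by move=> /(weight_space_root dR cG) [c ->]; rewrite rpredZ // rvec_wsp.
have rD (u v : 'M[k]_n) : mxev a (rAd g (u + v)) = mxev a (rAd g u) + mxev a (rAd g v).
  by rewrite rAdD mxevD.
move=> /wspP [t tT [c c0 ->]]; rewrite rD rpredD //.
  by apply: (wq 0) => //; [exact: lieT_G|exact: weight_lieT].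
have : {subset R <= R} by []; elim: {1 3}(R) => [_|h D IH DR].
  by rewrite big_nil rAdE // mulmx0 mul0mx mem0v.
rewrite big_cons rD rpredD ?IH //; last by move=> d dD; apply: DR; rewrite inE dD orbT.
have hR : h \in R by apply: DR; rewrite mem_head.
have [h0|/c0 ->] := boolP (degree_ge 0 h).
  by apply: (wq h) => //; [rewrite rpredZ // rvec_G|exact/weightZ/weight_rvec].
by rewrite scale0r rAdE // mulmx0 mul0mx mem0v.
Qed.

Lemma conj_T_q t Y : T t -> Y \in q -> t *m Y *m invmx t \in q.
Proof.
move=> Tt /wspP [u uT [c c0 ->]].
rewrite mulmxDr mulmxDl rpredD //.
  rewrite weight_lieT // wt0 scale1r; exact: (subvP (lieT_wsp _)).
rewrite mulmx_sumr mulmx_suml big_seq; apply: rpred_sum => g gR.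
rewrite -scalemxAr -scalemxAl weight_rvec //.
have [g0|/c0 ->] := boolP (degree_ge 0 g); last by rewrite scale0r mem0v.
by rewrite !rpredZ // rvec_wsp.
Qed.

Lemma sub_generated (S : set 'M[k]_n) : S `<=` generated S.
Proof. by move=> A SA H _; apply. Qed.

Lemma generated_sub (S H : set 'M[k]_n) : subgroup H -> S `<=` H -> generated S `<=` H.
Proof. by move=> sH SH A; apply. Qed.

(** The generators of P normalize [q], hence so does P, and by [lie_stab] so does Lie P;
    self-normalization of [q] bounds Lie P above. The lower bound comes from T and the root
    subgroups inside P. *)
Lemma lie_parabolic B : G2_borel T B phi -> lie (G2_parabolic1 B phi) = q.
Proof.
move=> BE; set P := G2_parabolic1 B phi.
have rootP_R g : g \in G2_pos_roots -> g \in R by move=> gp; rewrite mem_cat gp.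
have Pgen H : subgroup H -> T `<=` H ->
    (forall g, g \in R -> degree_ge 0 g -> root_subgroup phi g `<=` H) -> P `<=` H.
  move=> sH TH UH; apply: generated_sub => // A [|UA]; last exact: (UH (0, -1)).
  rewrite BE; apply: generated_sub => // {}A [/TH //|[g gp UA]].
  apply: (UH g) => //; first exact: rootP_R.
  by move: gp; have /allP H' : all (degree_ge 0) G2_pos_roots by []; exact: H'.
have BP : B `<=` P by move=> A BA; apply: sub_generated; left.
have TP : T `<=` P.
  by move=> A TA; apply: BP; rewrite BE; apply: sub_generated; left.
have UP g : g \in R -> degree_ge 0 g -> root_subgroup phi g `<=` P.
  move=> gR g0 A UA; have [gp|gn] := boolP (g \in G2_pos_roots).
    by apply: BP; rewrite BE; apply: sub_generated; right; exists g.
  apply: sub_generated; right; suff <- : g = (0, -1) by [].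
  have /allP H : all (fun g =>
        [|| g \in G2_pos_roots, ~~ degree_ge 0 g | g == (0, -1)]) R.
    by [].
  by have := H g gR; rewrite (negbTE gn) g0 /= => /eqP.
have PG : P `<=` G.
  by apply: Pgen => // g gR _ A [a _ <-]; apply: phi_G => //; exact: SL2_upper.
(* The condition is imposed on [A] and its inverse, which makes closure under inversion
   immediate. *)
pose N : set 'M[k]_n := [set A | [/\ A \in unitmx,
  forall Y, Y \in q -> A *m Y *m invmx A \in q &
  forall Y, Y \in q -> invmx A *m Y *m A \in q]].
have sN : subgroup N.
  split=> [A [] //||A C [uA A1 A2] [uC C1 C2]|A [uA A1 A2]].
  - by split=> [|Y|Y]; rewrite ?unitmx1 // invmx1 mul1mx mulmx1.
  - have iE : invmx (A *m C) = invmx C *m invmx A.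
      apply: invmx_uniq; rewrite mulmxA -(mulmxA A) mulmxV // mulmx1 mulmxV //.
    split=> [|Y Yq|Y Yq]; first by rewrite unitmx_mul uA uC.
      by rewrite iE -!mulmxA (mulmxA C) (mulmxA (C *m Y)) mulmxA; apply/A1/C1.
    by rewrite iE -!mulmxA (mulmxA (invmx A)) (mulmxA (_ *m Y)) mulmxA; apply/C2/A2.
  by split; rewrite ?unitmx_inv ?invmxK.
have PN : P `<=` N.
  apply: Pgen => // [t Tt|g gR g0 A [a _ <-]].
    split; [exact: T_unit|by move=> Y; exact: conj_T_q|move=> Y Yq].
    case: sgT => _ _ _ /(_ t Tt) Tv; have := conj_T_q Tv Yq.
    by rewrite invmxK.
  split; first by apply/G_unit/phi_G => //; exact: SL2_upper.
    by move=> Y Yq; rewrite phi_upper_inv // -rAdE // rAd_q.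
  by move=> Y Yq; rewrite phi_upper_inv // -rAdE // rAd_q.
apply/eqP; rewrite eqEsubv; apply/andP; split; last first.
  apply: wsp_subP => [|g gR g0]; first exact: lieS.
  by apply: (subvP (lieS (UP g gR g0))); rewrite lie_root // memv_line.
apply/subvP => X XP; apply: wsp_q_normalizer => [|v vq].
  exact: (subvP (lieS PG)).
rewrite brC -br_commutator //; apply: (lie_stab (S := P)) => //.
  by move=> A /PN [].
by move=> A Y /PN [_ H _]; exact: H.
Qed.

(** * The two subalgebras and the conclusion *)

Lemma wsp_ext (P Q : pred (int * int)) : {in R, P =1 Q} -> wsp P = wsp Q.
Proof.
by move=> PQ; apply/eqP; rewrite eqEsubv !wsp_sub // => g gR; rewrite PQ.
Qed.

(** [zeros] records the pairs whose sum is a root outside [P] but whose bracket vanishes; everything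
    else is a finite check on roots. *)
Lemma wsp_subalgebra (P : pred (int * int)) (zeros : seq ((int * int) * (int * int))) :
  all (fun g => all (fun h =>
    [&& P g, P h & g + h \in R] ==> P (g + h) || ((g, h) \in zeros)) R) R ->
  (forall gh, gh \in zeros -> br (rvec gh.1) (rvec gh.2) = 0) ->
  p_lie_subalgebra 2 (lie G) (wsp P).
Proof.
move=> /allP PP z; have brP X Y : X \in wsp P -> Y \in wsp P -> br X Y \in wsp P.
  apply: wsp_br => [g _ /orP[]|g h gR hR Pg Ph] //.
  have := allP (PP g gR) h hR; rewrite Pg Ph /=.
  have [gz _|_] := boolP ((g, h) \in zeros); first by rewrite (z (g, h)) // mem0v.
  by rewrite orbF => /implyP H; exact: br_root_wsp.
split=> [|X Y XP YP|X XP]; first by rewrite lieG_wsp wsp_sub.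
  by rewrite br_commutator // brP.
exact: wsp_sqr.
Qed.

(** Only alpha1 and alpha1+alpha2 move -2 alpha1-alpha2 to a root outside the set, namely one of
    degree -1; both brackets are zero. *)
Lemma deg0_N21_subalgebra : p_lie_subalgebra 2 (lie G) (wsp deg0_N21).
Proof.
apply: (@wsp_subalgebra _ [:: ((1, 0), (-2, -1)); ((-2, -1), (1, 0));
  ((1, 1), (-2, -1)); ((-2, -1), (1, 1))]) => // gh.
have [_ z _] := string_10.
by rewrite !inE => /or4P[] /eqP -> /=; rewrite ?z ?br_11_N21 // brC ?z ?br_11_N21.
Qed.

Lemma degN1_subalgebra : p_lie_subalgebra 2 (lie G) (wsp (degree_ge (-1))).
Proof.
apply: (@wsp_subalgebra _ [:: ((-1, 0), (-1, -1)); ((-1, -1), (-1, 0))]) => // gh.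
have [_ z _] := string_N10.
by rewrite !inE => /orP[] /eqP -> /=; rewrite ?z // brC ?z.
Qed.

Lemma wsp_neq (P Q : pred (int * int)) g : g \in R -> ~~ P g -> Q g -> wsp P <> wsp Q.
Proof.
move=> gR nPg Qg E; have := rvec_wsp P gR.
by rewrite E rvec_wsp // Qg (negbTE nPg).
Qed.

Lemma parabolic_overalgebras B (baseB : G2_borel T B phi) :
  let LieP := lie (G2_parabolic1 B phi) in
  let g (a b : int) := lie (root_subgroup phi (a, b)) in
  let g10 := g (-1) 0 in
  let g11 := g (-1) (-1) in
  let g21 := g (-2) (-1) in
  [/\ directv (LieP + g21), directv (LieP + g10 + g11) &
      forall s : {vspace 'M[k]_n},
        [/\ p_lie_subalgebra 2 (lie G) s, (LieP <= s)%VS, s <> LieP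
          & s <> lie G] <->
        s = (LieP + g21)%VS \/ s = (LieP + g10 + g11)%VS].
Proof.
move=> LieP g g10 g11 g21.
rewrite /LieP /g10 /g11 /g21 /g lie_parabolic // !lie_root //.
have hE : (q + <[e (-2) (-1)]>)%VS = wsp deg0_N21.
  rewrite wsp_cons //; apply: wsp_ext => r _.
  by rewrite /deg0_N21 /degree_ge /= orbC.
have lE : (q + <[e (-1)%R 0%R]> + <[e (-1) (-1)]>)%VS = wsp (degree_ge (-1)).
  rewrite !wsp_cons //; apply: wsp_ext => r rR; apply/eqP.
  by move: r rR; apply/allP.
split; first by apply/directv_addP; exact: wsp_disjoint.
- rewrite directv_addE directv_trivial andTb; apply/andP; split.
    by apply/directv_addP; exact: wsp_disjoint.
  suff : ((q + <[e (-1)%R 0%R]>) :&: <[e (-1)%R (-1)%R]> == 0)%VS by [].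
  by rewrite wsp_cons // wsp_disjoint.
move=> s; rewrite hE lE; split=> [[[sG sbr _] qs sNq sNG]|].
  apply: subalg_classify => // X Y Xs Ys; rewrite -br_commutator //; exact: sbr.
case=> ->; split.
- exact: deg0_N21_subalgebra.
- by apply: wsp_sub => r _ r0; rewrite /deg0_N21 [0 <= _]r0.
- by apply/nesym/(@wsp_neq _ _ (-2, -1)).
- by rewrite lieG_wsp; apply: (@wsp_neq _ _ (-1, 0)).
- exact: degN1_subalgebra.
- by apply: wsp_sub => r _; apply: Order.POrderTheory.le_trans.
- by apply/nesym/(@wsp_neq _ _ (-1, 0)).
- by rewrite lieG_wsp; apply: (@wsp_neq _ _ (-2, -1)).
Qed.

End Realization.

Lemma torus_comm (k : closedFieldType) (n : nat) (T : set 'M[k]_n) : torus T ->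
  forall s t, T s -> T t -> s *m t = t *m s.
Proof.
case=> _ _ [Q uQ TQ] s t /TQ /diag_mxP [a Ea] /TQ /diag_mxP [b Eb].
have conj (A B : 'M[k]_n) : Q *m (A *m B) *m invmx Q =
    (Q *m A *m invmx Q) *m (Q *m B *m invmx Q).
  by rewrite !mulmxA; congr (_ *m _ *m _); rewrite -!mulmxA mulVmx // mulmx1.
have := diag_mxC a b; rewrite -Ea -Eb -!conj => E.
have K (A : 'M[k]_n) : A = invmx Q *m (Q *m A *m invmx Q) *m Q.
  by rewrite !mulmxA mulVmx // mul1mx -mulmxA mulVmx // mulmx1.
by rewrite [LHS]K E -K.
Qed.

Theorem corollary2p24 (k : closedFieldType) (pchar2 : 2%N \in [pchar k])
    (n : nat) (G T B : set 'M[k]_n) (alpha1 alpha2 : 'M[k]_n -> k)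
    (phi : int * int -> 'M[k]_2 -> 'M[k]_n)
    (simpleG : simple_group G)
    (maxT : maximal_torus G T)
    (typeG2 : G2_realization G T alpha1 alpha2 phi)
    (borelB : borel G B)
    (baseB : G2_borel T B phi) :
  let LieP := lie (G2_parabolic1 B phi) in
  let g (a b : int) := lie (root_subgroup phi (a, b)) in
  let g10 := g (-1) 0 in
  let g11 := g (-1) (-1) in
  let g21 := g (-2) (-1) in
  [/\ directv (LieP + g21), directv (LieP + g10 + g11) &
      forall s : {vspace 'M[k]_n},
        [/\ p_lie_subalgebra 2 (lie G) s, (LieP <= s)%VS, s <> LieP
          & s <> lie G] <->
        s = (LieP + g21)%VS \/ s = (LieP + g10 + g11)%VS].
Proof.
have sgG : subgroup G by case: simpleG => [[]].
have [torT TG _] := maxT; have sgT : subgroup T by case: torT => [[]].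
exact: (parabolic_overalgebras pchar2 sgG sgT TG (torus_comm torT) typeG2 baseB).
Qed.
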